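(* Let $\mathcal B$ be a linearly ordered set, let $N\in\mathbb Z_+$, and let $C=C(N)$ be the free Lie conformal algebra generated by $\mathcal B$ corresponding to the constant locality function $N(a,b)\equiv N$. Let $L=\operatorname{Coeff}C$ be its Lie algebra of coefficients, $L_+\subset L$ its positive subalgebra, and $U=U(L)$ the universal enveloping algebra of $L$. (a) A basis of $U$ is given by all monomials $$a_1(n_1)\,a_2(n_2)\cdots a_k(n_k),\qquad k\ge 0,\ a_i\in\mathcal B,\ n_i\in\mathbb Z,$$ such that for every $1\le i<k$ $$n_i-n_{i+1}\le\begin{cases}N-1 & \text{if } a_i>a_{i+1}\text{ or }(a_i=a_{i+1}\text{ and }N\text{ is odd}),\\ N&\text{otherwise.}\end{cases}\qquad( * )$$ (b) A basis of the algebra $U(L_+)$ is given by all the monomials $a_1(n_1)\cdots a_k(n_k)$ satisfying $( * )$ and such that all $n_i\ge 0$. (c) Let $V=V(C)$ be the corresponding free vertex algebra. Then a basis of $V$ consists of the elements $$a_1(n_1)\,a_2(n_2)\cdots a_k(n_k)\mathbf 1,\qquad k\ge 0,\ a_i\in\mathcal B,\ n_i\in\mathbb Z,$$ such that $( * )$ holds for every $1\le i<k$ and, in addition, $n_k<0$ (when $k\ge1$).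
   Context: All spaces are over a field $\Bbbk$ of characteristic $0$; $\mathbb Z_+$ is the set of non-negative integers. The Lie algebra $L=\operatorname{Coeff}C$: it is the Lie algebra presented by the set of generators $X=\{b(n)\mid b\in\mathcal B,\ n\in\mathbb Z\}$ and the relations $$\sum_{s=0}^{N}(-1)^s\binom Ns[b(n-s),a(m+s)]=0\qquad(a,b\in\mathcal B,\ m,n\in\mathbb Z).$$ The free Lie conformal algebra $C=C(N)$: for $b\in\mathcal B$ put $\tilde b=\sum_{n\in\mathbb Z}b(n)z^{-n-1}\in L[[z,z^{-1}]]$. On $L[[z,z^{-1}]]$ consider $D=d/dz$ and, for $n\in\mathbb Z_+$, the circle products $(a\circ_n b)(m)=\sum_{s=0}^n(-1)^s\binom ns[a(n-s),b(m+s)]$, where $a(z)=\sum_n a(n)z^{-n-1}$. Then $C\subset L[[z,z^{-1}]]$ is the smallest linear subspace containing all $\tilde b$ ($b\in\mathcal B$) and closed under $D$ and all $\circ_n$, $n\in\mathbb Z_+$. The positive subalgebra is $L_+=\operatorname{Span}\{c(n)\mid c\in C,\ n\ge0\}\subset L$. The free vertex algebra $V=V(C)$ is the universal enveloping vertex algebra of $C$. Its underlying linear space (and $L$-module) is the Verma-type module $V=U(L)\otimes_{U(L_+)}\Bbbk\mathbf 1\cong U(L)/U(L)L_+$, induced from the one-dimensional trivial $L_+$-module $\Bbbk\mathbf 1$; $\mathbf 1$ denotes the image of $1$. The expression $a_1(n_1)\cdots a_k(n_k)\mathbf 1$ is the result of acting by $a_1(n_1)\cdots a_k(n_k)\in U(L)$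 on $\mathbf 1$. *)

(* Defs.v *)
From HB Require Import structures.
From mathcomp Require Import all_boot all_order all_algebra.
From mathcomp Require Import boolp.

Set Implicit Arguments.
Unset Strict Implicit.
Unset Printing Implicit Defensive.

Import Order.TTheory GRing.Theory Num.Theory.
Local Open Scope ring_scope.
Local Open Scope quotient_scope.

Section LinearAlgebra.
Variables (k : fieldType) (M : lmodType k).

Definition lspan (S : M -> Prop) (x : M) : Prop :=
  exists (n : nat) (a : 'I_n -> k) (v : 'I_n -> M),
    (forall i, S (v i)) /\ x = \sum_i a i *: v i.

(* The family (v i), i ranging over the indices with P i, is a basis of M.
   This is a statement about families: distinct indices give distinct
   basis vectors. *)
Definition is_basis (I : eqType) (P : pred I) (v : I -> M) : Prop :=
  (forall (s : seq I) (c : I -> k), uniq s -> all P s ->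
     \sum_(i <- s) c i *: v i = 0 -> forall i, i \in s -> c i = 0) /\
  (forall x : M, exists (s : seq I) (c : I -> k),
     all P s /\ x = \sum_(i <- s) c i *: v i).

Lemma lspan_gen (S : M -> Prop) x : S x -> lspan S x.
Proof.
move=> Sx; exists 1%N, (fun=> 1), (fun=> x); split=> //.
by rewrite big_ord1 scale1r.
Qed.

Lemma lspan0 (S : M -> Prop) : lspan S 0.
Proof. by exists 0%N, (fun=> 0), (fun=> 0); split=> [[]|] //; rewrite big_ord0. Qed.

Lemma lspanZ (S : M -> Prop) a x : lspan S x -> lspan S (a *: x).
Proof.
case=> n [c [v [Sv ->]]]; exists n, (fun i => a * c i), v; split=> //.
by rewrite scaler_sumr; apply: eq_bigr => i _; rewrite scalerA.
Qed.

Lemma lspanD (S : M -> Prop) x y : lspan S x -> lspan S y -> lspan S (x + y).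
Proof.
case=> m [a [v [Sv ->]]] [n [b [w [Sw ->]]]].
exists (m + n)%N, (fun i => match split i with inl j => a j | inr j => b j end),
  (fun i => match split i with inl j => v j | inr j => w j end).
split=> [i|]; first by case: (split i).
rewrite big_split_ord /=; congr (_ + _); apply: eq_bigr => i _.
  by rewrite -[lshift n i]/(unsplit (inl i)) unsplitK.
by rewrite -[rshift m i]/(unsplit (inr i)) unsplitK.
Qed.

Lemma lspan_sum (S : M -> Prop) (I : Type) (r : seq I) (P : pred I) (F : I -> M) :
  (forall i, P i -> lspan S (F i)) -> lspan S (\sum_(i <- r | P i) F i).
Proof. by move=> SF; apply: big_ind => //; [exact: lspan0 | exact: lspanD]. Qed.

Definition lspan_pred (S : M -> Prop) : {pred M} := fun x => `[< lspan S x >].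

Lemma lspan_predP (S : M -> Prop) x : reflect (lspan S x) (x \in lspan_pred S).
Proof. exact: asboolP. Qed.

Lemma lspan_pred_submod (S : M -> Prop) : submod_closed (lspan_pred S).
Proof.
split=> [|a x y]; first exact/lspan_predP/lspan0.
move=> /lspan_predP Sx /lspan_predP Sy.
by apply/lspan_predP/lspanD => //; apply: lspanZ.
Qed.
HB.instance Definition _ (S : M -> Prop) :=
  GRing.isSubmodClosed.Build k M (lspan_pred S) (lspan_pred_submod S).

End LinearAlgebra.

HB.mixin Record Lmodule_isLieAlgebra (k : fieldType) L of GRing.Lmodule k L := {
  lie : L -> L -> L;
  lieDl : forall x y z, lie (x + y) z = lie x z + lie y z;
  lieDr : forall x y z, lie x (y + z) = lie x y + lie x z;
  lieZl : forall a x y, lie (a *: x) y = a *: lie x y;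
  lieZr : forall a x y, lie x (a *: y) = a *: lie x y;
  liexx : forall x, lie x x = 0;
  lie_jacobi : forall x y z,
    lie x (lie y z) + lie y (lie z x) + lie z (lie x y) = 0
}.

#[short(type="lieAlgType")]
HB.structure Definition LieAlgebra (k : fieldType) :=
  {L of GRing.Lmodule k L & Lmodule_isLieAlgebra k L}.

Section LieTheory.
Variables (k : fieldType) (L : lieAlgType k).

Lemma lie0r (x : L) : lie x 0 = 0.
Proof. by rewrite -[X in lie x X](scale0r 0) lieZr scale0r. Qed.

Lemma lie0l (x : L) : lie 0 x = 0.
Proof. by rewrite -[X in lie X x](scale0r 0) lieZl scale0r. Qed.

Lemma lie_suml (I : Type) (r : seq I) (P : pred I) (F : I -> L) y :
  lie (\sum_(i <- r | P i) F i) y = \sum_(i <- r | P i) lie (F i) y.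
Proof. by apply: (big_morph (fun x => lie x y)) => [x z|]; [exact: lieDl | exact: lie0l]. Qed.

Lemma lie_sumr (I : Type) (r : seq I) (P : pred I) (F : I -> L) y :
  lie y (\sum_(i <- r | P i) F i) = \sum_(i <- r | P i) lie y (F i).
Proof. by apply: (big_morph (lie y)) => [x z|]; [exact: lieDr | exact: lie0r]. Qed.

End LieTheory.

(* [pres_lie R] is the quotient of the formal Lie expressions over X by the
   smallest congruence containing the axioms of Lie algebras and [t = 0] for
   every relator [t]. *)

Inductive lie_term (k X : Type) : Type :=
  | LGen of X
  | LZero
  | LAdd of lie_term k X & lie_term k X
  | LScale of k & lie_term k X
  | LBr of lie_term k X & lie_term k X.
Arguments LGen {k X}.
Arguments LZero {k X}.

HB.instance Definition _ k X := gen_eqMixin (lie_term k X).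
HB.instance Definition _ k X := gen_choiceMixin (lie_term k X).

Section PresentedLie.
Variables (k : fieldType) (X : Type) (R : lie_term k X -> Prop).
Implicit Types (s t u : lie_term k X) (a b : k).

Inductive lie_cong : lie_term k X -> lie_term k X -> Prop :=
  | LC_refl t : lie_cong t t
  | LC_sym s t : lie_cong s t -> lie_cong t s
  | LC_trans s t u : lie_cong s t -> lie_cong t u -> lie_cong s u
  | LC_add s s' t t' : lie_cong s s' -> lie_cong t t' ->
      lie_cong (LAdd s t) (LAdd s' t')
  | LC_scale a s s' : lie_cong s s' -> lie_cong (LScale a s) (LScale a s')
  | LC_br s s' t t' : lie_cong s s' -> lie_cong t t' ->
      lie_cong (LBr s t) (LBr s' t')
  | LC_addA s t u : lie_cong (LAdd s (LAdd t u)) (LAdd (LAdd s t) u)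
  | LC_addC s t : lie_cong (LAdd s t) (LAdd t s)
  | LC_add0 t : lie_cong (LAdd LZero t) t
  | LC_addN t : lie_cong (LAdd (LScale (-1) t) t) LZero
  | LC_scaleA a b t : lie_cong (LScale a (LScale b t)) (LScale (a * b) t)
  | LC_scale1 t : lie_cong (LScale 1 t) t
  | LC_scaleDr a s t :
      lie_cong (LScale a (LAdd s t)) (LAdd (LScale a s) (LScale a t))
  | LC_scaleDl a b t :
      lie_cong (LScale (a + b) t) (LAdd (LScale a t) (LScale b t))
  | LC_brDl s t u : lie_cong (LBr (LAdd s t) u) (LAdd (LBr s u) (LBr t u))
  | LC_brDr s t u : lie_cong (LBr s (LAdd t u)) (LAdd (LBr s t) (LBr s u))
  | LC_brZl a s t : lie_cong (LBr (LScale a s) t) (LScale a (LBr s t))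
  | LC_brZr a s t : lie_cong (LBr s (LScale a t)) (LScale a (LBr s t))
  | LC_brxx t : lie_cong (LBr t t) LZero
  | LC_jacobi s t u :
      lie_cong (LAdd (LAdd (LBr s (LBr t u)) (LBr t (LBr u s)))
                     (LBr u (LBr s t))) LZero
  | LC_rel t : R t -> lie_cong t LZero.

Definition lie_congb : rel (lie_term k X) := fun s t => `[< lie_cong s t >].

Lemma lie_congb_refl : reflexive lie_congb.
Proof. by move=> t; apply/asboolP/LC_refl. Qed.
Lemma lie_congb_sym : symmetric lie_congb.
Proof. by move=> s t; apply/asboolP/asboolP => /LC_sym. Qed.
Lemma lie_congb_trans : transitive lie_congb.
Proof. by move=> t s u /asboolP st /asboolP tu; apply/asboolP/(LC_trans st tu). Qed.

Canonical lie_cong_equiv :=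
  EquivRel lie_congb lie_congb_refl lie_congb_sym lie_congb_trans.

Definition pres_lie : Type := {eq_quot lie_congb}.
HB.instance Definition _ := Choice.on pres_lie.
HB.instance Definition _ : EqQuotient _ lie_congb pres_lie :=
  EqQuotient.on pres_lie.

Lemma pres_eqP s t : \pi_pres_lie s = \pi_pres_lie t <-> lie_cong s t.
Proof. by split=> [/eqquotP/asboolP | h] //; apply/eqquotP/asboolP. Qed.

Lemma pres_repr t : lie_cong (repr (\pi_pres_lie t)) t.
Proof. by apply/pres_eqP; rewrite reprK. Qed.

Definition pres_zero : pres_lie := \pi_pres_lie LZero.
Definition pres_add := lift_op2 pres_lie (@LAdd k X).
Definition pres_scale a := lift_op1 pres_lie (LScale a).
Definition pres_opp (x : pres_lie) : pres_lie := pres_scale (-1) x.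
Definition pres_br := lift_op2 pres_lie (@LBr k X).

Lemma pres_addE s t : pres_add (\pi_pres_lie s) (\pi_pres_lie t) = \pi_pres_lie (LAdd s t).
Proof. rewrite /pres_add -lock; apply/pres_eqP/LC_add; apply: pres_repr. Qed.
Lemma pres_scaleE a t : pres_scale a (\pi_pres_lie t) = \pi_pres_lie (LScale a t).
Proof. rewrite /pres_scale -lock; apply/pres_eqP/LC_scale; apply: pres_repr. Qed.
Lemma pres_brE s t : pres_br (\pi_pres_lie s) (\pi_pres_lie t) = \pi_pres_lie (LBr s t).
Proof. rewrite /pres_br -lock; apply/pres_eqP/LC_br; apply: pres_repr. Qed.

Definition presE := (pres_addE, pres_scaleE, pres_brE).

Fact pres_addA : associative pres_add.
Proof.
elim/quotW=> s; elim/quotW=> t; elim/quotW=> u.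
by rewrite !presE; apply/pres_eqP/LC_addA.
Qed.
Fact pres_addC : commutative pres_add.
Proof. by elim/quotW=> s; elim/quotW=> t; rewrite !presE; apply/pres_eqP/LC_addC. Qed.
Fact pres_add0 : left_id pres_zero pres_add.
Proof. by elim/quotW=> s; rewrite !presE; apply/pres_eqP/LC_add0. Qed.
Fact pres_addN : left_inverse pres_zero pres_opp pres_add.
Proof. by elim/quotW=> s; rewrite /pres_opp !presE; apply/pres_eqP/LC_addN. Qed.
HB.instance Definition _ :=
  GRing.isZmodule.Build pres_lie pres_addA pres_addC pres_add0 pres_addN.

Fact pres_scaleA a b (x : pres_lie) :
  pres_scale a (pres_scale b x) = pres_scale (a * b) x.
Proof. by elim/quotW: x => s; rewrite !presE; apply/pres_eqP/LC_scaleA. Qed.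
Fact pres_scale1 : left_id 1 pres_scale.
Proof. by elim/quotW=> s; rewrite !presE; apply/pres_eqP/LC_scale1. Qed.
Fact pres_scaleDr : right_distributive pres_scale +%R.
Proof.
move=> a; elim/quotW=> s; elim/quotW=> t.
by rewrite /GRing.add /= !presE; apply/pres_eqP/LC_scaleDr.
Qed.
Fact pres_scaleDl (x : pres_lie) : {morph pres_scale^~ x : a b / a + b}.
Proof.
move=> a b; elim/quotW: x => s.
by rewrite [RHS]/GRing.add /= !presE; apply/pres_eqP/LC_scaleDl.
Qed.
HB.instance Definition _ := GRing.Zmodule_isLmodule.Build k pres_lie
  pres_scaleA pres_scale1 pres_scaleDr pres_scaleDl.

Fact pres_brDl (x y z : pres_lie) :
  pres_br (x + y) z = pres_br x z + pres_br y z.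
Proof.
elim/quotW: x => s; elim/quotW: y => t; elim/quotW: z => u.
by rewrite /GRing.add /= !presE; apply/pres_eqP/LC_brDl.
Qed.
Fact pres_brDr (x y z : pres_lie) :
  pres_br x (y + z) = pres_br x y + pres_br x z.
Proof.
elim/quotW: x => s; elim/quotW: y => t; elim/quotW: z => u.
by rewrite /GRing.add /= !presE; apply/pres_eqP/LC_brDr.
Qed.
Fact pres_brZl a (x y : pres_lie) : pres_br (a *: x) y = a *: pres_br x y.
Proof.
elim/quotW: x => s; elim/quotW: y => t.
by rewrite /GRing.scale /= !presE; apply/pres_eqP/LC_brZl.
Qed.
Fact pres_brZr a (x y : pres_lie) : pres_br x (a *: y) = a *: pres_br x y.
Proof.
elim/quotW: x => s; elim/quotW: y => t.
by rewrite /GRing.scale /= !presE; apply/pres_eqP/LC_brZr.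
Qed.
Fact pres_brxx (x : pres_lie) : pres_br x x = 0.
Proof. by elim/quotW: x => s; rewrite presE; apply/pres_eqP/LC_brxx. Qed.
Fact pres_jacobi (x y z : pres_lie) :
  pres_br x (pres_br y z) + pres_br y (pres_br z x) + pres_br z (pres_br x y)
  = 0.
Proof.
elim/quotW: x => s; elim/quotW: y => t; elim/quotW: z => u.
by rewrite /GRing.add /= !presE; apply/pres_eqP/LC_jacobi.
Qed.
HB.instance Definition _ := Lmodule_isLieAlgebra.Build k pres_lie
  pres_brDl pres_brDr pres_brZl pres_brZr pres_brxx pres_jacobi.

Definition pres_gen (x : X) : pres_lie := \pi_pres_lie (LGen x).

End PresentedLie.

Section PresentedLieUniversal.
Variables (k : fieldType) (X : Type) (M : lieAlgType k) (g : X -> M).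

Fixpoint lie_eval (t : lie_term k X) : M :=
  match t with
  | LGen x => g x
  | LZero => 0
  | LAdd s t => lie_eval s + lie_eval t
  | LScale a t => a *: lie_eval t
  | LBr s t => lie (lie_eval s) (lie_eval t)
  end.

(* The universal property of [pres_lie R]: every map from X to a Lie algebra
   that kills the relators factors through the quotient. *)
Lemma lie_eval_cong (R : lie_term k X -> Prop) :
  (forall t, R t -> lie_eval t = 0) ->
  forall s t, lie_cong R s t -> lie_eval s = lie_eval t.
Proof.
move=> Rg s t; elim=> {s t} /=;
  [by []|by []|by move=> s t u _ -> _|by move=> s s' t t' _ -> _ ->
  |by move=> a s s' _ ->|by move=> s s' t t' _ -> _ ->|..].
- by move=> s t u; rewrite addrA.
- by move=> s t; rewrite addrC.
- by move=> t; rewrite add0r.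
- by move=> t; rewrite scaleN1r addNr.
- by move=> a b t; rewrite scalerA.
- by move=> t; rewrite scale1r.
- by move=> a s t; rewrite scalerDr.
- by move=> a b t; rewrite scalerDl.
- by move=> s t u; rewrite lieDl.
- by move=> s t u; rewrite lieDr.
- by move=> a s t; rewrite lieZl.
- by move=> a s t; rewrite lieZr.
- by move=> t; rewrite liexx.
- by move=> s t u; rewrite lie_jacobi.
- exact: Rg.
Qed.

End PresentedLieUniversal.

(* [uea L] is the quotient of the formal expressions of unital associative
   k-algebras over the letters [UIn x], x in L, by the smallest congruence that
   contains the axioms of such algebras, makes [UIn] linear and contains
   [UIn [x, y] = UIn x * UIn y - UIn y * UIn x]. *)

Inductive uea_term (k L : Type) : Type :=
  | UIn of L
  | UZero
  | UOne
  | UAdd of uea_term k L & uea_term k L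
  | UScale of k & uea_term k L
  | UMul of uea_term k L & uea_term k L.
Arguments UIn {k L}.
Arguments UZero {k L}.
Arguments UOne {k L}.

HB.instance Definition _ k L := gen_eqMixin (uea_term k L).
HB.instance Definition _ k L := gen_choiceMixin (uea_term k L).

Section EnvelopingAlgebra.
Variables (k : fieldType) (L : lieAlgType k).
Implicit Types (s t u : uea_term k L) (a b : k) (x y : L).

Inductive uea_cong : uea_term k L -> uea_term k L -> Prop :=
  | UC_refl t : uea_cong t t
  | UC_sym s t : uea_cong s t -> uea_cong t s
  | UC_trans s t u : uea_cong s t -> uea_cong t u -> uea_cong s u
  | UC_add s s' t t' : uea_cong s s' -> uea_cong t t' ->
      uea_cong (UAdd s t) (UAdd s' t')
  | UC_scale a s s' : uea_cong s s' -> uea_cong (UScale a s) (UScale a s')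
  | UC_mul s s' t t' : uea_cong s s' -> uea_cong t t' ->
      uea_cong (UMul s t) (UMul s' t')
  | UC_addA s t u : uea_cong (UAdd s (UAdd t u)) (UAdd (UAdd s t) u)
  | UC_addC s t : uea_cong (UAdd s t) (UAdd t s)
  | UC_add0 t : uea_cong (UAdd UZero t) t
  | UC_addN t : uea_cong (UAdd (UScale (-1) t) t) UZero
  | UC_scaleA a b t : uea_cong (UScale a (UScale b t)) (UScale (a * b) t)
  | UC_scale1 t : uea_cong (UScale 1 t) t
  | UC_scaleDr a s t :
      uea_cong (UScale a (UAdd s t)) (UAdd (UScale a s) (UScale a t))
  | UC_scaleDl a b t :
      uea_cong (UScale (a + b) t) (UAdd (UScale a t) (UScale b t))
  | UC_mulA s t u : uea_cong (UMul s (UMul t u)) (UMul (UMul s t) u)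
  | UC_mul1l t : uea_cong (UMul UOne t) t
  | UC_mul1r t : uea_cong (UMul t UOne) t
  | UC_mulDl s t u : uea_cong (UMul (UAdd s t) u) (UAdd (UMul s u) (UMul t u))
  | UC_mulDr s t u : uea_cong (UMul s (UAdd t u)) (UAdd (UMul s t) (UMul s u))
  | UC_mulZl a s t : uea_cong (UScale a (UMul s t)) (UMul (UScale a s) t)
  | UC_mulZr a s t : uea_cong (UScale a (UMul s t)) (UMul s (UScale a t))
  | UC_inD x y : uea_cong (UIn (x + y)) (UAdd (UIn x) (UIn y))
  | UC_inZ a x : uea_cong (UIn (a *: x)) (UScale a (UIn x))
  | UC_in_lie x y : uea_cong (UIn (lie x y))
      (UAdd (UMul (UIn x) (UIn y)) (UScale (-1) (UMul (UIn y) (UIn x)))).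

Definition uea_congb : rel (uea_term k L) := fun s t => `[< uea_cong s t >].

Lemma uea_congb_refl : reflexive uea_congb.
Proof. by move=> t; apply/asboolP/UC_refl. Qed.
Lemma uea_congb_sym : symmetric uea_congb.
Proof. by move=> s t; apply/asboolP/asboolP => /UC_sym. Qed.
Lemma uea_congb_trans : transitive uea_congb.
Proof. by move=> t s u /asboolP st /asboolP tu; apply/asboolP/(UC_trans st tu). Qed.

Canonical uea_cong_equiv :=
  EquivRel uea_congb uea_congb_refl uea_congb_sym uea_congb_trans.

Definition uea : Type := {eq_quot uea_congb}.
HB.instance Definition _ := Choice.on uea.
HB.instance Definition _ : EqQuotient _ uea_congb uea := EqQuotient.on uea.

Lemma uea_eqP s t : \pi_uea s = \pi_uea t <-> uea_cong s t.
Proof. by split=> [/eqquotP/asboolP | h] //; apply/eqquotP/asboolP. Qed.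

Lemma uea_repr t : uea_cong (repr (\pi_uea t)) t.
Proof. by apply/uea_eqP; rewrite reprK. Qed.

(* Evaluation in an associative algebra along a Lie algebra morphism; with
   [uea_eval_cong] this is the universal property of [uea]. *)
Fixpoint uea_eval (A : algType k) (f : L -> A) (t : uea_term k L) : A :=
  match t with
  | UIn x => f x
  | UZero => 0
  | UOne => 1
  | UAdd s t => uea_eval f s + uea_eval f t
  | UScale a t => a *: uea_eval f t
  | UMul s t => uea_eval f s * uea_eval f t
  end.

Lemma uea_eval_cong (A : algType k) (f : L -> A) :
  linear f -> (forall x y, f (lie x y) = f x * f y - f y * f x) ->
  forall s t, uea_cong s t -> uea_eval f s = uea_eval f t.
Proof.
move=> flin flie s t; have f0: f 0 = 0.
  by have := flin (-1) 0 0; rewrite scaler0 addr0 scaleN1r addNr.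
elim=> {s t} /=;
  [by []|by []|by move=> s t u _ -> _|by move=> s s' t t' _ -> _ ->
  |by move=> a s s' _ ->|by move=> s s' t t' _ -> _ ->|..].
- by move=> s t u; rewrite addrA.
- by move=> s t; rewrite addrC.
- by move=> t; rewrite add0r.
- by move=> t; rewrite scaleN1r addNr.
- by move=> a b t; rewrite scalerA.
- by move=> t; rewrite scale1r.
- by move=> a s t; rewrite scalerDr.
- by move=> a b t; rewrite scalerDl.
- by move=> s t u; rewrite mulrA.
- by move=> t; rewrite mul1r.
- by move=> t; rewrite mulr1.
- by move=> s t u; rewrite mulrDl.
- by move=> s t u; rewrite mulrDr.
- by move=> a s t; rewrite scalerAl.
- by move=> a s t; rewrite scalerAr.
- by move=> x y; have := flin 1 x y; rewrite !scale1r.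
- by move=> a x; have := flin a x 0; rewrite !addr0 f0 addr0.
- by move=> x y; rewrite flie scaleN1r.
Qed.

Definition uea_zero : uea := \pi_uea UZero.
Definition uea_one : uea := \pi_uea UOne.
Definition uea_add := lift_op2 uea (@UAdd k L).
Definition uea_scale a := lift_op1 uea (UScale a).
Definition uea_opp (x : uea) : uea := uea_scale (-1) x.
Definition uea_mul := lift_op2 uea (@UMul k L).

Lemma uea_addE s t : uea_add (\pi_uea s) (\pi_uea t) = \pi_uea (UAdd s t).
Proof. rewrite /uea_add -lock; apply/uea_eqP/UC_add; apply: uea_repr. Qed.
Lemma uea_scaleE a t : uea_scale a (\pi_uea t) = \pi_uea (UScale a t).
Proof. rewrite /uea_scale -lock; apply/uea_eqP/UC_scale; apply: uea_repr. Qed.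
Lemma uea_mulE s t : uea_mul (\pi_uea s) (\pi_uea t) = \pi_uea (UMul s t).
Proof. rewrite /uea_mul -lock; apply/uea_eqP/UC_mul; apply: uea_repr. Qed.

Definition ueaE := (uea_addE, uea_scaleE, uea_mulE).

Fact uea_addA : associative uea_add.
Proof.
elim/quotW=> s; elim/quotW=> t; elim/quotW=> u.
by rewrite !ueaE; apply/uea_eqP/UC_addA.
Qed.
Fact uea_addC : commutative uea_add.
Proof. by elim/quotW=> s; elim/quotW=> t; rewrite !ueaE; apply/uea_eqP/UC_addC. Qed.
Fact uea_add0 : left_id uea_zero uea_add.
Proof. by elim/quotW=> s; rewrite !ueaE; apply/uea_eqP/UC_add0. Qed.
Fact uea_addN : left_inverse uea_zero uea_opp uea_add.
Proof. by elim/quotW=> s; rewrite /uea_opp !ueaE; apply/uea_eqP/UC_addN. Qed.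
HB.instance Definition _ :=
  GRing.isZmodule.Build uea uea_addA uea_addC uea_add0 uea_addN.

Fact uea_mulA : associative uea_mul.
Proof.
elim/quotW=> s; elim/quotW=> t; elim/quotW=> u.
by rewrite !ueaE; apply/uea_eqP/UC_mulA.
Qed.
Fact uea_mul1l : left_id uea_one uea_mul.
Proof. by elim/quotW=> s; rewrite !ueaE; apply/uea_eqP/UC_mul1l. Qed.
Fact uea_mul1r : right_id uea_one uea_mul.
Proof. by elim/quotW=> s; rewrite !ueaE; apply/uea_eqP/UC_mul1r. Qed.
Fact uea_mulDl : left_distributive uea_mul +%R.
Proof.
elim/quotW=> s; elim/quotW=> t; elim/quotW=> u.
by rewrite /GRing.add /= !ueaE; apply/uea_eqP/UC_mulDl.
Qed.
Fact uea_mulDr : right_distributive uea_mul +%R.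
Proof.
elim/quotW=> s; elim/quotW=> t; elim/quotW=> u.
by rewrite /GRing.add /= !ueaE; apply/uea_eqP/UC_mulDr.
Qed.
Fact uea_one_neq0 : uea_one != 0.
Proof.
apply/eqP => /uea_eqP /(@uea_eval_cong k^o (fun=> 0)) /=.
move=> /(_ _ _)/eqP; rewrite oner_eq0 => H.
suff: false by []; apply: H => [a x y|x y]; last by rewrite mulr0 subrr.
by rewrite scaler0 addr0.
Qed.
HB.instance Definition _ := GRing.Zmodule_isNzRing.Build uea
  uea_mulA uea_mul1l uea_mul1r uea_mulDl uea_mulDr uea_one_neq0.

Fact uea_scaleA a b (x : uea) :
  uea_scale a (uea_scale b x) = uea_scale (a * b) x.
Proof. by elim/quotW: x => s; rewrite !ueaE; apply/uea_eqP/UC_scaleA. Qed.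
Fact uea_scale1 : left_id 1 uea_scale.
Proof. by elim/quotW=> s; rewrite !ueaE; apply/uea_eqP/UC_scale1. Qed.
Fact uea_scaleDr : right_distributive uea_scale +%R.
Proof.
move=> a; elim/quotW=> s; elim/quotW=> t.
by rewrite /GRing.add /= !ueaE; apply/uea_eqP/UC_scaleDr.
Qed.
Fact uea_scaleDl (x : uea) : {morph uea_scale^~ x : a b / a + b}.
Proof.
move=> a b; elim/quotW: x => s.
by rewrite [RHS]/GRing.add /= !ueaE; apply/uea_eqP/UC_scaleDl.
Qed.
HB.instance Definition _ := GRing.Zmodule_isLmodule.Build k uea
  uea_scaleA uea_scale1 uea_scaleDr uea_scaleDl.

Fact uea_scaleAl a (x y : uea) : a *: (x * y) = (a *: x) * y.
Proof.
elim/quotW: x => s; elim/quotW: y => t.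
by rewrite /GRing.scale /GRing.mul /= !ueaE; apply/uea_eqP/UC_mulZl.
Qed.
Fact uea_scaleAr a (x y : uea) : a *: (x * y) = x * (a *: y).
Proof.
elim/quotW: x => s; elim/quotW: y => t.
by rewrite /GRing.scale /GRing.mul /= !ueaE; apply/uea_eqP/UC_mulZr.
Qed.
HB.instance Definition _ := GRing.Lmodule_isLalgebra.Build k uea uea_scaleAl.
HB.instance Definition _ := GRing.Lalgebra_isAlgebra.Build k uea uea_scaleAr.

Definition uea_in (x : L) : uea := \pi_uea (UIn x).

End EnvelopingAlgebra.

(* For a Lie subalgebra S of L, the L-module induced from the trivial
   S-module k 1, as the quotient U(L) / U(L) S by the left ideal generated
   by S. *)

Section InducedModule.
Variables (k : fieldType) (L : lieAlgType k) (S : L -> Prop).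

Definition left_ideal : {pred uea L} :=
  lspan_pred (fun z => exists (u : uea L) (x : L), S x /\ z = u * uea_in x).

HB.instance Definition _ := GRing.SubmodClosed.on left_ideal.

Definition induced : Type := Quotient.quot left_ideal.
HB.instance Definition _ := GRing.Zmodule.on induced.
HB.instance Definition _ := EqQuotient.on induced.

Lemma induced_eqP (u v : uea L) :
  \pi_induced u = \pi_induced v <-> u - v \in left_ideal.
Proof. by split=> [/eqP|h]; [|apply/eqP]; rewrite -Quotient.idealrBE. Qed.

Lemma induced_repr (u : uea L) : repr (\pi_induced u) - u \in left_ideal.
Proof. by apply/induced_eqP; rewrite reprK. Qed.

Lemma induced_addE (u v : uea L) :
  \pi_induced u + \pi_induced v = \pi_induced (u + v).
Proof. by rewrite piE. Qed.

Definition induced_scale (a : k) := lift_op1 induced ( *:%R a).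

Lemma induced_scaleE a (u : uea L) : induced_scale a (\pi_induced u) = \pi_induced (a *: u).
Proof.
rewrite /induced_scale -lock; apply/induced_eqP.
by rewrite -scalerBr rpredZ // induced_repr.
Qed.

Fact induced_scaleA a b (v : induced) :
  induced_scale a (induced_scale b v) = induced_scale (a * b) v.
Proof. by elim/quotW: v => u; rewrite !induced_scaleE scalerA. Qed.
Fact induced_scale1 : left_id 1 induced_scale.
Proof. by elim/quotW=> u; rewrite induced_scaleE scale1r. Qed.
Fact induced_scaleDr : right_distributive induced_scale +%R.
Proof.
move=> a; elim/quotW=> u; elim/quotW=> v.
by rewrite induced_addE !induced_scaleE induced_addE scalerDr.
Qed.
Fact induced_scaleDl (v : induced) : {morph induced_scale^~ v : a b / a + b}.
Proof.
by move=> a b; elim/quotW: v => u; rewrite !induced_scaleE induced_addE scalerDl.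
Qed.
HB.instance Definition _ := GRing.Zmodule_isLmodule.Build k induced
  induced_scaleA induced_scale1 induced_scaleDr induced_scaleDl.

Definition induced_vac : induced := \pi_induced 1.

Definition induced_act (x : L) (v : induced) : induced :=
  \pi_induced (uea_in x * repr v).

Lemma left_idealMl (u z : uea L) : z \in left_ideal -> u * z \in left_ideal.
Proof.
move=> /lspan_predP[n [a [v [Sv ->]]]]; rewrite mulr_sumr.
apply: rpred_sum => i _; rewrite -scalerAr rpredZ //.
have [w [x [Sx ->]]] := Sv i; apply/lspan_predP/lspan_gen.
by exists (u * w), x; rewrite mulrA.
Qed.

Lemma induced_actE (x : L) (u : uea L) :
  induced_act x (\pi_induced u) = \pi_induced (uea_in x * u).
Proof. by apply/induced_eqP; rewrite -mulrBr left_idealMl // induced_repr. Qed.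

End InducedModule.

Section FreeConformal.
Variables (k : fieldType) (B : Type) (N : nat).

(* The term \sum_{s <= N} (-1)^s C(N,s) [b(n-s), a(m+s)]; the letter b(n) is
   [LGen (b, n)]. *)
Definition locality_term (a b : B) (m n : int) : lie_term k (B * int) :=
  \big[@LAdd k _/LZero]_(s < N.+1)
    LScale ((-1) ^+ s * 'C(N, s)%:R)
      (LBr (LGen (b, n - s%:Z)) (LGen (a, m + s%:Z))).

Definition locality_rel (t : lie_term k (B * int)) : Prop :=
  exists (a b : B) (m n : int), t = locality_term a b m n.

Definition coeffL : Type := pres_lie locality_rel.
HB.instance Definition _ := LieAlgebra.on coeffL.

Definition gen (b : B) (n : int) : coeffL := pres_gen locality_rel (b, n).

(* Elements of L[[z,z^{-1}]]: the series \sum_n a(n) z^{-n-1} is the function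
   n |-> a(n). *)
Definition series := int -> coeffL.

Definition gen_series (b : B) : series := fun n => gen b n.

(* d/dz (\sum_n a(n) z^{-n-1}) = \sum_n (-n) a(n-1) z^{-n-1}. *)
Definition Dseries (a : series) : series := fun n => (- n)%:~R *: a (n - 1).

Definition circ (n : nat) (a b : series) : series := fun m =>
  \sum_(s < n.+1)
    ((-1) ^+ s * 'C(n, s)%:R) *: lie (a (n%:Z - s%:Z)) (b (m + s%:Z)).

(* The smallest subspace of L[[z,z^{-1}]] containing the generating series and
   closed under d/dz and all circle products. *)
Inductive conformal : series -> Prop :=
  | Conf_gen b : conformal (gen_series b)
  | Conf_zero : conformal (fun=> 0)
  | Conf_add a b : conformal a -> conformal b -> conformal (fun n => a n + b n)
  | Conf_scale (c : k) a : conformal a -> conformal (fun n => c *: a n)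
  | Conf_D a : conformal a -> conformal (Dseries a)
  | Conf_circ n a b : conformal a -> conformal b -> conformal (circ n a b).

Definition coeff_ge0 (x : coeffL) : Prop :=
  exists (c : series) (n : nat), conformal c /\ x = c n%:Z.

Definition is_Lplus (x : coeffL) : Prop := lspan coeff_ge0 x.

Definition Lplus_pred : {pred coeffL} := lspan_pred coeff_ge0.
HB.instance Definition _ := GRing.SubmodClosed.on Lplus_pred.

Lemma lie_coeff_ge0 (c d : series) (m n : nat) :
  conformal c -> conformal d -> lspan coeff_ge0 (lie (c m%:Z) (d n%:Z)).
Proof.
move=> Cc Cd; elim/ltn_ind: m n => m IH n.
have : lspan coeff_ge0 (circ m c d n).
  by apply: lspan_gen; exists (circ m c d), n; split=> //; apply: Conf_circ.
rewrite /circ big_ord_recl /= bin0 expr0 mulr1 scale1r subr0 addr0 => H.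
rewrite -[X in lspan _ X](addrK (\sum_(i < m)
  ((-1) ^+ i.+1 * 'C(m, i.+1)%:R) *: lie (c (m%:Z - i.+1%:Z)) (d (n%:Z + i.+1%:Z)))).
apply: lspanD; first exact: H.
rewrite -scaleN1r; apply/lspanZ/lspan_sum => i _; apply: lspanZ.
by rewrite subzn // -PoszD; apply: IH; rewrite subnSK // leq_subr.
Qed.

Lemma Lplus_lie x y : x \in Lplus_pred -> y \in Lplus_pred -> lie x y \in Lplus_pred.
Proof.
move=> /lspan_predP[p [a [v [Sv ->]]]] /lspan_predP[q [b [w [Sw ->]]]].
apply/lspan_predP; rewrite lie_suml; apply: lspan_sum => i _.
rewrite lie_sumr; apply: lspan_sum => j _.
rewrite lieZl lieZr; do 2!apply: lspanZ.
by have [c [m [Cc ->]]] := Sv i; have [d [n [Cd ->]]] := Sw j; apply: lie_coeff_ge0.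
Qed.

Record Lplus : Type := MkLplus {
  Lplus_val :> coeffL;
  Lplus_valP : Lplus_val \in Lplus_pred
}.
HB.instance Definition _ := [isSub for Lplus_val].
HB.instance Definition _ := [Choice of Lplus by <:].
HB.instance Definition _ := [SubChoice_isSubLmodule of Lplus by <:].

Definition Lplus_br (x y : Lplus) : Lplus :=
  MkLplus (Lplus_lie (Lplus_valP x) (Lplus_valP y)).

Fact Lplus_brDl (x y z : Lplus) : Lplus_br (x + y) z = Lplus_br x z + Lplus_br y z.
Proof. by apply: val_inj; rewrite /= lieDl. Qed.
Fact Lplus_brDr (x y z : Lplus) : Lplus_br x (y + z) = Lplus_br x y + Lplus_br x z.
Proof. by apply: val_inj; rewrite /= lieDr. Qed.
Fact Lplus_brZl a (x y : Lplus) : Lplus_br (a *: x) y = a *: Lplus_br x y.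
Proof. by apply: val_inj; rewrite /= lieZl. Qed.
Fact Lplus_brZr a (x y : Lplus) : Lplus_br x (a *: y) = a *: Lplus_br x y.
Proof. by apply: val_inj; rewrite /= lieZr. Qed.
Fact Lplus_brxx (x : Lplus) : Lplus_br x x = 0.
Proof. by apply: val_inj; rewrite /= liexx. Qed.
Fact Lplus_jacobi (x y z : Lplus) :
  Lplus_br x (Lplus_br y z) + Lplus_br y (Lplus_br z x) + Lplus_br z (Lplus_br x y) = 0.
Proof. by apply: val_inj; rewrite /= lie_jacobi. Qed.
HB.instance Definition _ := Lmodule_isLieAlgebra.Build k Lplus
  Lplus_brDl Lplus_brDr Lplus_brZl Lplus_brZr Lplus_brxx Lplus_jacobi.

Lemma gen_Lplus (b : B) (n : nat) : gen b n%:Z \in Lplus_pred.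
Proof.
apply/lspan_predP/lspan_gen.
by exists (gen_series b), n; split=> //; apply: Conf_gen.
Qed.

Definition genp (b : B) (n : nat) : Lplus := MkLplus (gen_Lplus b n).

(* The universal enveloping vertex algebra of C has U(L) / U(L) L_+ as its
   underlying L-module. *)
Definition freeV : Type := induced is_Lplus.
HB.instance Definition _ := GRing.Lmodule.on freeV.

End FreeConformal.

Section Monomials.
Variables (k : fieldType) (d : Order.disp_t) (B : orderType d) (N : nat).

(* A word [:: (a1, n1); ...; (ak, nk)] stands for a1(n1) ... ak(nk). *)

Definition admissible_pair (x y : B * int) : bool :=
  x.2 - y.2 <=
    (if (x.1 > y.1)%O || ((x.1 == y.1) && odd N) then N%:Z - 1 else N%:Z).

Definition admissible (w : seq (B * int)) : bool := sorted admissible_pair w.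

Definition last_neg (w : seq (B * int)) : bool :=
  if w is x :: w' then (last x w').2 < 0 else true.

Definition U_monomial (w : seq (B * int)) : uea (coeffL k B N) :=
  \prod_(x <- w) uea_in (gen k N x.1 x.2).

(* In U(L_+) only the letters a(n) with n >= 0 are available, hence the words
   over B * nat. *)
Definition Uplus_monomial (w : seq (B * nat)) : uea (Lplus k B N) :=
  \prod_(x <- w) uea_in (genp k N x.1 x.2).

Definition V_monomial (w : seq (B * int)) : freeV k B N :=
  foldr (fun x v => induced_act (gen k N x.1 x.2) v) (induced_vac _) w.

End Monomials.

(* Main.v *)
Require Import Defs.
From HB Require Import structures.
From mathcomp Require Import all_boot all_order all_algebra.
From mathcomp Require Import boolp functions.
From mathcomp Require Import zify ring.

(** U(L) is the associative algebra on the letters b(n) modulo locality.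

    Spanning. A pair b(n) a(m) violating ( * ) has n - m >= N, and locality
    rewrites it through pairs whose exponents lie between m and n and whose first
    exponent is smaller, or equal with the two letters exchanged into increasing
    order. This terminates, and it never leaves the words with nonnegative
    exponents. L_+ is generated by the b(n) with n >= 0, so the same rewriting
    applies to U(L_+).

    Independence. Put on the variables z_1, ..., z_k colours in B. The expansions
    of z^mu \prod_(i < j) (z_i - z_j)^-N in the regions
    |z_s(1)| > |z_s(2)| > ... are correlation functions: multiplication by
    (z_i - z_j)^N removes the pole, so they define functionals on U(L). Words
    satisfying ( * ) correspond bijectively to coloured monomials z^mu with mu
    decreasing, and the pairing is triangular for the dominance order, with
    nonzero diagonal in characteristic 0. If mu >= 0 the functional kills the
    words ending in b(n) with n >= 0, hence the left ideal U L_+, which gives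
    independence in V. For U(L_+) it follows from the map U(L_+) -> U(L). *)

Set Implicit Arguments.
Unset Strict Implicit.
Unset Printing Implicit Defensive.

Import Order.TTheory GRing.Theory Num.Theory.
Local Open Scope ring_scope.
Local Open Scope quotient_scope.

(** * Endomorphism algebras and universal properties *)

Section LinearEndomorphisms.
Variables (k : fieldType) (M : lmodType k).

Definition linear_pred : {pred M -> M} := fun f => `[< linear f >].

Fact linear_pred_submod : submod_closed linear_pred.
Proof.
split=> [|a f g /asboolP lf /asboolP lg]; apply/asboolP => b u v.
  by rewrite scaler0 addr0.
rewrite !fctE lf lg !scalerDr !scalerA [b * a]mulrC !addrA.
by congr (_ + _); rewrite -!addrA; congr (_ + _); rewrite addrC.
Qed.
HB.instance Definition _ :=
  GRing.isSubmodClosed.Build k (M -> M) linear_pred linear_pred_submod.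

(* The parameter [M_neq0] makes [lend M_neq0] a nontrivial ring. *)
Record lend (M_neq0 : exists v : M, v != 0) : Type :=
  Lend { lend_fun :> M -> M; lend_linear : lend_fun \in linear_pred }.

Section LendAlgebra.
Variable M_neq0 : exists v : M, v != 0.
Notation lend := (lend M_neq0).
Notation Lend := (@Lend M_neq0 _).

HB.instance Definition _ := [isSub for @lend_fun M_neq0].
HB.instance Definition _ := [Choice of lend by <:].
HB.instance Definition _ := [SubChoice_isSubLmodule of lend by <:].

Lemma lendP (f : lend) : linear f.
Proof. exact/asboolP/lend_linear. Qed.

Lemma lend_id : idfun \in linear_pred.
Proof. by apply/asboolP. Qed.

Lemma lend_comp (f g : lend) : f \o g \in linear_pred.
Proof. by apply/asboolP => a u v; rewrite /= !lendP. Qed.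

Lemma lend_eqP (f g : lend) : f =1 g -> f = g.
Proof. by move=> fg; apply/val_inj/funext. Qed.

Definition lend_one := Lend lend_id.
Definition lend_mul (f g : lend) := Lend (lend_comp f g).

Fact lend_mulA : associative lend_mul.
Proof. by move=> f g h; apply: lend_eqP. Qed.
Fact lend_mul1 : left_id lend_one lend_mul.
Proof. by move=> f; apply: lend_eqP. Qed.
Fact lend_mulr1 : right_id lend_one lend_mul.
Proof. by move=> f; apply: lend_eqP. Qed.
Fact lend_mulDl : left_distributive lend_mul +%R.
Proof. by move=> f g h; apply: lend_eqP. Qed.
Fact lend_mulDr : right_distributive lend_mul +%R.
Proof.
move=> f g h; apply: lend_eqP => v /=.
by have := lendP f 1 (g v) (h v); rewrite !scale1r.
Qed.
Fact lend_one_neq0 : lend_one != 0.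
Proof.
have [v v0] := M_neq0; apply/eqP => /(congr1 (fun f : lend => f v)) /= e.
by rewrite e eqxx in v0.
Qed.
HB.instance Definition _ := GRing.Zmodule_isNzRing.Build lend
  lend_mulA lend_mul1 lend_mulr1 lend_mulDl lend_mulDr lend_one_neq0.

Fact lend_scaleAl a (f g : lend) : a *: (f * g) = (a *: f) * g.
Proof. exact: lend_eqP. Qed.
Fact lend_scaleAr a (f g : lend) : a *: (f * g) = f * (a *: g).
Proof.
apply: lend_eqP => v /=; have := lendP f a (g v) 0; rewrite !addr0 => ->.
have := lendP f (-1) 0 0; rewrite scaler0 addr0 scaleN1r addNr => ->.
by rewrite addr0.
Qed.
HB.instance Definition _ := GRing.Lmodule_isLalgebra.Build k lend lend_scaleAl.
HB.instance Definition _ := GRing.Lalgebra_isAlgebra.Build k lend lend_scaleAr.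

Lemma lend_addE (f g : lend) v : (f + g) v = f v + g v. Proof. by []. Qed.
Lemma lend_scaleE a (f : lend) v : (a *: f) v = a *: f v. Proof. by []. Qed.
Lemma lend_sumE (I : Type) (r : seq I) (P : pred I) (F : I -> lend) v :
  (\sum_(i <- r | P i) F i) v = \sum_(i <- r | P i) F i v.
Proof. exact: (big_morph (fun f : lend => f v)). Qed.

End LendAlgebra.

End LinearEndomorphisms.

Section CommutatorLie.
Variables (k : fieldType) (A : algType k).

(** A separate name for [A], so that the commutator bracket is the Lie structure of this copy and
    maps from a presented Lie algebra can end in it. *)
Definition comm_lie : Type := A.
HB.instance Definition _ := GRing.Lmodule.on comm_lie.

Definition comm_br (x y : A) : A := x * y - y * x.

Fact comm_brDl (x y z : comm_lie) : comm_br (x + y) z = comm_br x z + comm_br y z :> comm_lie.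
Proof. by rewrite /comm_br mulrDl mulrDr opprD addrACA. Qed.
Fact comm_brDr (x y z : comm_lie) : comm_br x (y + z) = comm_br x y + comm_br x z :> comm_lie.
Proof. by rewrite /comm_br mulrDl mulrDr opprD addrACA. Qed.
Fact comm_brZl a (x y : comm_lie) : comm_br (a *: x) y = a *: comm_br x y :> comm_lie.
Proof. by rewrite /comm_br -scalerAl -scalerAr scalerBr. Qed.
Fact comm_brZr a (x y : comm_lie) : comm_br x (a *: y) = a *: comm_br x y :> comm_lie.
Proof. by rewrite /comm_br -scalerAl -scalerAr scalerBr. Qed.
Fact comm_brxx (x : comm_lie) : comm_br x x = 0 :> comm_lie.
Proof. exact: subrr. Qed.
Fact comm_jacobi (x y z : comm_lie) :
  comm_br x (comm_br y z) + comm_br y (comm_br z x) + comm_br z (comm_br x y) = 0 :> comm_lie.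
Proof.
rewrite /comm_br !mulrBr !mulrBl !mulrA !opprB.
rewrite !addrA.
by rewrite [LHS](ACl ((1*12)*(7*2)*(3*10)*(5*4)*(11*6)*(9*8))%AC) /= !subrr !addr0.
Qed.
HB.instance Definition _ := Lmodule_isLieAlgebra.Build k comm_lie
  comm_brDl comm_brDr comm_brZl comm_brZr comm_brxx comm_jacobi.
End CommutatorLie.

Section UniversalProperties.

(** Congruent terms have equal values by [lie_eval_cong], so the map may evaluate any representative
    of a class. *)
Lemma pres_lie_universal (k : fieldType) (X : Type) (R : lie_term k X -> Prop)
    (M : lieAlgType k) (g : X -> M) :
  (forall t, R t -> lie_eval g t = 0) ->
  exists F : pres_lie R -> M, [/\ linear F,
    forall x y, F (lie x y) = lie (F x) (F y) & forall x, F (pres_gen R x) = g x].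
Proof.
move=> Rg; exists (fun x : pres_lie R => lie_eval g (repr x)).
have FE t : lie_eval g (repr (\pi_(pres_lie R) t)) = lie_eval g t.
  exact: (lie_eval_cong Rg (pres_repr R t)).
split=> [a x y|x y|x]; last exact: FE.
- elim/quotW: x => s; elim/quotW: y => t.
  by rewrite /GRing.add /GRing.scale /= !presE !FE.
- elim/quotW: x => s; elim/quotW: y => t.
  by rewrite [lie _ _](presE R).2 !FE.
Qed.

Lemma uea_universal (k : fieldType) (L : lieAlgType k) (A : algType k) (f : L -> A) :
  linear f -> (forall x y, f (lie x y) = f x * f y - f y * f x) ->
  exists F : {lrmorphism uea L -> A}, forall x, F (uea_in x) = f x.
Proof.
move=> flin flie.
pose F (u : uea L) : A := uea_eval f (repr u).
have FE t : F (\pi_(uea L) t) = uea_eval f t.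
  exact: (uea_eval_cong flin flie (uea_repr t)).
have Flin : linear F.
  move=> a x y; elim/quotW: x => s; elim/quotW: y => t.
  by rewrite [X in F X]/GRing.add [X in F (_ X _)]/GRing.scale /= !ueaE !FE.
have Fmul : monoid_morphism F.
  split=> [|x y]; first by rewrite [X in F X]/GRing.one /= FE.
  elim/quotW: x => s; elim/quotW: y => t.
  by rewrite [X in F X]/GRing.mul /= !ueaE !FE.
pose Fl := GRing.isLinear.Build k (uea L) A _ F Flin.
pose Fm := GRing.isMonoidMorphism.Build (uea L) A F Fmul.
pose FF : {lrmorphism uea L -> A} := HB.pack F Fl Fm.
by exists FF => x; apply: FE.
Qed.

End UniversalProperties.

Lemma minimal_deg (I : eqType) (deg : I -> int) (s : seq I) :
  s != [::] -> exists2 i, i \in s & forall j, j \in s -> deg i <= deg j.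
Proof.
elim: s => // x [|y s] IH _.
  by exists x => [|j]; rewrite inE // => /eqP ->.
have [i si imin] := IH isT; have [le|lt] := leP (deg x) (deg i).
  exists x => [|j]; first exact: mem_head.
  by rewrite inE => /predU1P[->|/imin]; last exact: le_trans.
exists i => [|j]; first by rewrite inE si orbT.
by rewrite inE => /predU1P[->|/imin //]; apply: ltW.
Qed.

(** Among the indices with nonzero coefficient take [i] of minimal degree: [phi i] sees only [v i]
    and vectors of smaller degree, whose coefficients vanish. Only the values [phi i] of the
    combination enter, so the argument also works modulo a subspace. *)
Lemma triangular_free (k : fieldType) (M : lmodType k) (I : eqType) (P : pred I)
    (v : I -> M) (deg : I -> int) (phi : I -> M -> k) :
  (forall i a x y, phi i (a *: x + y) = a * phi i x + phi i y) ->
  (forall i, P i -> phi i (v i) != 0) ->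
  (forall i j, P i -> P j -> phi i (v j) != 0 -> j = i \/ deg j < deg i) ->
  forall (s : seq I) (c : I -> k), uniq s -> all P s ->
    (forall i, P i -> phi i (\sum_(j <- s) c j *: v j) = 0) ->
  forall i, i \in s -> c i = 0.
Proof.
move=> phil phi1 phi2 s c us sP s0.
have phi0 i : phi i 0 = 0.
  by have := phil i (-1) 0 0; rewrite scaler0 addr0 mulN1r addNr.
have phis i : phi i (\sum_(j <- s) c j *: v j) = \sum_(j <- s) c j * phi i (v j).
  elim: (s) => [|j t IH]; first by rewrite !big_nil.
  by rewrite !big_cons phil IH.
case: (boolP (has (fun i => c i != 0) s)) => [sc|/hasPn sc i /sc /negPn/eqP //].
have [|i] := @minimal_deg _ deg [seq i <- s | c i != 0]; first by rewrite -has_filter.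
rewrite mem_filter => /andP[ci si] imin.
have Pi := allP sP i si; have := s0 i Pi.
rewrite phis (bigD1_seq i) //= big1_seq ?addr0 => [/eqP|j /andP[ji sj]].
  by rewrite mulf_eq0 (negbTE ci) (negbTE (phi1 i Pi)).
apply/eqP; rewrite mulf_eq0; case: eqP => //= /eqP cj; apply/negPn/negP => pj.
case: (phi2 i j Pi (allP sP j sj) pj) => [e|]; first by rewrite e eqxx in ji.
by rewrite ltNge imin // mem_filter cj.
Qed.

(** * The operators of the correlation functions *)

Section BinomialInversion.
Variable k : fieldType.

(* The coefficients of (1 - t)^-N; for N = 0 the truncated predecessor gives
   1, 0, 0, ... as it should. *)
Definition wt (N e : nat) : k := 'C((N + e).-1, e)%:R.

Lemma wt0 N : wt N 0 = 1. Proof. by rewrite /wt bin0. Qed.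

Lemma wtS N e : wt N.+1 e.+1 = wt N e.+1 + wt N.+1 e.
Proof. by rewrite /wt !addSn !addnS /= binS natrD. Qed.

(** Pascal's rule: one factor of (1 - T)^(N+1) is split off, where T shifts the argument of [F] by
    one. *)
Lemma sum_signed_binS (N : nat) (F : nat -> k) :
  \sum_(s < N.+2) (-1) ^+ s * 'C(N.+1, s)%:R * F s
  = \sum_(s < N.+1) (-1) ^+ s * 'C(N, s)%:R * (F s - F s.+1).
Proof.
under [RHS]eq_bigr do rewrite mulrBr.
rewrite sumrB [in RHS]big_ord_recl [in LHS]big_ord_recl /= !bin0 -addrA; congr (_ + _).
under eq_bigr => s _ do rewrite /bump /= ?add1n binS natrD mulrDr mulrDl.
rewrite big_split /= big_ord_recr /= bin_small // mulr0 mul0r addr0.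
congr (_ + _); rewrite -sumrN; apply: eq_bigr => s _.
by rewrite exprS mulN1r !mulNr.
Qed.

(** This is (1 - t) (1 - t)^-(N+1) = (1 - t)^-N, truncated; [F R.+1 = 0] removes the boundary
    term. *)
Lemma wt_sumS (N R : nat) (F : nat -> k) : F R.+1 = 0 ->
  \sum_(e < R.+1) wt N.+1 e * F e - \sum_(e < R.+1) wt N.+1 e * F e.+1
  = \sum_(e < R.+1) wt N e * F e.
Proof.
move=> F0; rewrite [X in _ - X]big_ord_recr /= F0 mulr0 addr0.
rewrite big_ord_recl [RHS]big_ord_recl !wt0 /= -addrA; congr (_ + _).
rewrite -sumrB; apply: eq_bigr => e _.
by rewrite /bump /= ?add1n wtS mulrDl addrK.
Qed.

(* (1 - t)^N (1 - t)^-N = 1 *)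
Lemma wt_inv (N R : nat) (F : nat -> k) : (forall l, (R <= l)%N -> F l = 0) ->
  \sum_(s < N.+1) (-1) ^+ s * 'C(N, s)%:R * (\sum_(e < R.+1) wt N e * F (s + e)%N) = F 0.
Proof.
elim: N F => [|N IH] F F0.
  rewrite big_ord1 bin0 !mul1r big_ord_recl wt0 mul1r big1 ?addr0 // => e _.
  by rewrite /wt /bump /= ?add1n add0n bin_small // mul0r.
rewrite (sum_signed_binS _ (fun s => \sum_(e < R.+1) wt N.+1 e * F (s + e)%N)).
rewrite -[RHS](IH F F0); apply: eq_bigr => s _; congr (_ * _).
rewrite -(@wt_sumS N R (fun e => F (s + e)%N)); last by apply: F0; lia.
by congr (_ - _); apply: eq_bigr => e _; rewrite addSnnS.
Qed.

End BinomialInversion.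

(** * Coefficient extraction from Laurent monomials, and locality *)

Section Model.
Variables (k : fieldType) (N n : nat) (B : eqType) (col : 'I_n -> B).
Notation I := 'I_n.
Notation wt := (wt k N).
Implicit Types (i j l : I) (J : seq I) (mu nu : I -> int) (h : (I -> int) -> k) (r s : int).

Definition shift i (c : nat) mu : I -> int := fun l => mu l + (c * (l == i))%:Z.
Definition reset i mu : I -> int := fun l => if l == i then 0 else mu l.

Lemma shiftC i c j d mu : shift i c (shift j d mu) = shift j d (shift i c mu).
Proof. by apply/funext => l; rewrite /shift addrAC. Qed.
Lemma shift0 i mu : shift i 0 mu = mu.
Proof. by apply/funext => l; rewrite /shift mul0n addr0. Qed.
Lemma resetC i j mu : reset i (reset j mu) = reset j (reset i mu).
Proof. by apply/funext => l; rewrite /reset; do 2!case: eqP. Qed.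
Lemma reset_shift i c mu : reset i (shift i c mu) = reset i mu.
Proof. by apply/funext => l; rewrite /reset /shift; case: eqP => //; rewrite muln0 addr0. Qed.
Lemma shift_reset i j c mu : i != j -> reset i (shift j c mu) = shift j c (reset i mu).
Proof.
move=> ij; apply/funext => l; rewrite /reset /shift; case: (eqVneq l i) => // ->.
by rewrite (negbTE ij) muln0 addr0.
Qed.

(* The coefficient of t^r in \prod_(i <- J) (1 - t S_i)^-N applied to [h], where
   S_i is the operator h |-> h \o shift i 1. *)
Fixpoint hsum J r h mu : k :=
  match J with
  | [::] => (r == 0)%:R * h mu
  | i :: J' => \sum_(e < `|r|.+1) wt e * hsum J' (r - e%:Z) h (shift i e mu)
  end.

Lemma hsum_lt0 J r h mu : r < 0 -> hsum J r h mu = 0.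
Proof.
elim: J r mu => [|i J IH] r mu r0 /=; first by rewrite lt_eqF // mul0r.
by rewrite big1 // => e _; rewrite IH ?mulr0 //; lia.
Qed.

(** Terms with [e] above [r] have negative degree and vanish, so any bound above [r] will do. A
    common bound allows sums to be interchanged. *)
Lemma hsum_cons i J r h mu (R : nat) : r < R%:Z ->
  hsum (i :: J) r h mu = \sum_(e < R) wt e * hsum J (r - e%:Z) h (shift i e mu).
Proof.
move=> rR; have vanish m : (`|r| < m)%N -> hsum J (r - m%:Z) h (shift i m mu) = 0.
  by move=> lt; apply: hsum_lt0; lia.
have [r0|r0] := ltP r 0.
  by rewrite hsum_lt0 // big1 // => e _; rewrite hsum_lt0 ?mulr0 //; lia.
rewrite /= (big_ord_widen R (fun e => wt e * hsum J (r - e%:Z) h (shift i e mu))); last by lia.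
rewrite big_mkcond; apply: eq_bigr => e _; case: ltnP => // le.
by rewrite vanish // mulr0.
Qed.

Lemma hsum_eq J r h h' mu : h =1 h' -> hsum J r h mu = hsum J r h' mu.
Proof. by move=> /funext ->. Qed.

Lemma hsum_lin J r (T : Type) (t : seq T) (P : pred T) (a : T -> k) (h : T -> (I -> int) -> k) mu :
  hsum J r (fun nu => \sum_(x <- t | P x) a x * h x nu) mu
  = \sum_(x <- t | P x) a x * hsum J r (h x) mu.
Proof.
elim: J r mu => [|i J IH] r mu /=.
  by rewrite mulr_sumr; apply: eq_bigr => x _; rewrite mulrCA.
under eq_bigr do rewrite IH mulr_sumr.
rewrite exchange_big /=; apply: eq_bigr => x _; rewrite mulr_sumr.
by apply: eq_bigr => e _; rewrite mulrCA.
Qed.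

Lemma hsum_shift J r h i c mu :
  hsum J r (fun nu => h (shift i c nu)) mu = hsum J r h (shift i c mu).
Proof.
elim: J r mu => [|j J IH] r mu //=.
by apply: eq_bigr => e _; rewrite IH shiftC.
Qed.

Lemma hsum_reset J r h i mu : i \notin J ->
  hsum J r (fun nu => h (reset i nu)) mu = hsum J r h (reset i mu).
Proof.
elim: J r mu => [|j J IH] r mu //=; rewrite inE negb_or => /andP[ij iJ].
by apply: eq_bigr => e _; rewrite IH // shift_reset.
Qed.

(** In a composite of letter operators the inner degree depends on the exponent of the variable
    removed second; no variable of [J] shifts that exponent, so it can be frozen. *)
Lemma hsum_const J r (h : int -> (I -> int) -> k) i mu : i \notin J ->
  hsum J r (fun nu => h (nu i) nu) mu = hsum J r (h (mu i)) mu.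
Proof.
elim: J r mu => [|j J IH] r mu //=; rewrite inE negb_or => /andP[ij iJ].
by apply: eq_bigr => e _; rewrite IH // [shift j e mu i]/shift (negbTE ij) muln0 addr0.
Qed.

(** Both operators are polynomials in the shifts, which commute. *)
Lemma hsumC J J' r s h mu :
  hsum J r (hsum J' s h) mu = hsum J' s (hsum J r h) mu.
Proof.
elim: J r mu => [|i J IH] r mu /=.
  rewrite -(big_seq1 GRing.add tt (fun=> _ * _)).
  by rewrite -hsum_lin; apply: hsum_eq => nu; rewrite big_seq1.
under eq_bigr do rewrite IH -hsum_shift.
by rewrite -hsum_lin.
Qed.

(** The factors (1 - t S_i)^-N commute, so that of [j] can be expanded first. *)
Lemma hsum_rem j J r h mu (R : nat) : j \in J -> r < R%:Z ->
  hsum J r h mu = \sum_(e < R) wt e * hsum (rem j J) (r - e%:Z) h (shift j e mu).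
Proof.
elim: J r mu => // i J IH r mu; rewrite inE rem_cons => + rR.
case: (eqVneq i j) => [-> _|ij jJ]; first exact: hsum_cons.
rewrite (hsum_cons _ _ _ _ rR).
under eq_bigr => e _ do (rewrite IH ?mulr_sumr //; last by lia).
rewrite exchange_big; apply: eq_bigr => e _.
rewrite (@hsum_cons _ _ _ _ _ R) ?mulr_sumr; last by lia.
by apply: eq_bigr => c _; rewrite shiftC mulrCA -!addrA [- _ + - _]addrC.
Qed.

Definition sgn1 i l : k := (-1) ^+ (N * (l < i)%N).
Definition order_sign i J : k := \prod_(l <- J) sgn1 i l.

Lemma sgn1C i j : i != j -> sgn1 j i = (-1) ^+ N * sgn1 i j.
Proof.
move=> ij; rewrite /sgn1; have : (i < j)%N != (j < i)%N.
  by move: ij; rewrite -val_eqE /=; case: ltngtP.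
case: (i < j)%N; case: (j < i)%N => // _; rewrite ?muln0 ?muln1 ?mulr1 //.
by rewrite -exprD addnn -mul2n exprM sqrrN !expr1n.
Qed.

Notation M := (seq I -> (I -> int) -> k^o).

(* With M the dual of the Laurent monomials z^mu in variables z_i, i in J,
   the operator b(n) takes the coefficient of z_i^(-n-1), for each i of colour b,
   in z^mu \prod_(i < l) (z_i - z_l)^-N expanded in the region where z_i is the
   largest. The sign comes from the orientation of the factors (z_l - z_i)^-N with
   l < i, and [reset i] forgets the exponent of the variable that was removed. *)
Definition letter_op (x : B * int) (g : M) : M := fun J mu =>
  if uniq J then
    \sum_(i <- J | col i == x.1) order_sign i (rem i J) *
      hsum (rem i J) (x.2 + 1 + mu i - (N * (size J).-1)%:Z) (g (rem i J)) (reset i mu)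
  else 0.

(** The coefficient for removing z_i and z_j once the pole at z_i = z_j is gone: only the poles at
    third variables are expanded. *)
Definition hsum2 (g : M) J mu r s i j : k :=
  let J' := rem j (rem i J) in hsum J' r (hsum J' s (g J')) (reset j (reset i mu)).

Lemma remC i j J : rem i (rem j J) = rem j (rem i J).
Proof.
elim: J => //= l J IH; case: (eqVneq l i) => [<-|li]; case: (eqVneq l j) => [<-|lj] //=.
- by rewrite eqxx.
- by rewrite eqxx.
- by rewrite (negbTE li) (negbTE lj) IH.
Qed.

Lemma hsum2C g J mu r s i j : hsum2 g J mu r s i j = hsum2 g J mu s r j i.
Proof. by rewrite /hsum2 hsumC resetC remC. Qed.

Lemma hsum2_lt0 g J mu r s i j : r < 0 -> hsum2 g J mu r s i j = 0.
Proof. exact: hsum_lt0. Qed.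

(** The degree offset that counts only the |J| - 2 poles at third variables. The truncation concerns
    fewer than two variables, where there is no pair to sum over. *)
Definition rho J mu i : int := 1 + mu i - (N * (size J).-2)%:Z.

(** Only the factor (1 - z_j / z_i)^-N couples the two variables: its term of degree [e] lowers the
    degree left for z_i by [e] and raises that for z_j by [e]. The bound [R] is a parameter so that
    it can be chosen uniformly in the locality sum. *)
Lemma letter_op_comp x y g J mu (R : I -> nat) : uniq J ->
  (forall i, x.2 + rho J mu i - N%:Z < (R i)%:Z) ->
  letter_op x (letter_op y g) J mu = \sum_(i <- J | col i == x.1) \sum_(j <- rem i J | col j == y.1)
    sgn1 i j * (order_sign i (rem j (rem i J)) * order_sign j (rem j (rem i J))) *
    \sum_(e < R i) wt e *
       hsum2 g J mu (x.2 + rho J mu i - N%:Z - e%:Z) (y.2 + rho J mu j + e%:Z) i j.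
Proof.
move=> uJ rR; rewrite {1}/letter_op uJ.
rewrite [LHS]big_seq_cond [RHS]big_seq_cond; apply: eq_bigr => i /andP[iJ _].
have ui := rem_uniq i uJ; have szi := size_rem iJ.
rewrite /letter_op ui hsum_lin mulr_sumr.
rewrite [LHS]big_seq_cond [RHS]big_seq_cond; apply: eq_bigr => j /andP[jJ _].
have ji : j != i by apply: contraTneq jJ => ->; rewrite mem_rem_uniqF.
have jJ' : j \notin rem j (rem i J) by rewrite mem_rem_uniqF.
have [p sJ] : exists p, size J = p.+2.
  by exists (size J).-2; move: szi; case: (rem i J) jJ => //= a t _; case: (size J) => //= -[].
rewrite {1}/order_sign (perm_big _ (perm_to_rem jJ)) big_cons -/(order_sign _ _) /=.
rewrite -!mulrA; congr (_ * (_ * (_ * _))).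
rewrite (@hsum_rem j _ _ _ _ (R i)) //; last first.
  by have := rR i; rewrite /rho sJ /= mulnS; lia.
apply: eq_bigr => e _; congr (_ * _).
rewrite (@hsum_const _ _ (fun z nu => hsum _ (y.2 + 1 + z - _) _ (reset j nu))) //.
rewrite (@hsum_reset _ _ (hsum _ _ _)) // reset_shift /hsum2; congr (hsum _ _ (hsum _ _ _) _).
  by rewrite /rho sJ /= mulnS; lia.
by rewrite szi /rho sJ /= /shift /reset eqxx (negbTE ji) muln1; lia.
Qed.

Lemma exchange_big_rem (V : zmodType) J (P Q : pred I) (F : I -> I -> V) :
  \sum_(i <- J | P i) \sum_(j <- rem i J | Q j) F i j
  = \sum_(j <- J | Q j) \sum_(i <- rem j J | P i) F i j.
Proof.
have E (P' Q' : pred I) (G : I -> I -> V) :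
    \sum_(i <- J | P' i) \sum_(j <- rem i J | Q' j) G i j
    = \sum_(i <- J | P' i) \sum_(j <- J | Q' j) G i j - \sum_(i <- J | P' i && Q' i) G i i.
  rewrite [X in _ - X]big_mkcondr -sumrB.
  rewrite [LHS]big_seq_cond [RHS]big_seq_cond; apply: eq_bigr => i /andP[iJ _].
  by rewrite [X in _ = X - _](big_rem i iJ) /= [X in X - _]addrC addrK.
rewrite !E exchange_big; congr (_ - _); apply: eq_bigl => i; exact: andbC.
Qed.

Definition sgn2 J i j : k :=
  let J' := rem j (rem i J) in sgn1 i j * (order_sign i J' * order_sign j J').

(** The signed binomial sum multiplies by (1 - z_j / z_i)^N, which cancels the coupling factor by
    [wt_inv]. *)
Lemma letter_op_signed_sum b a (p m : int) g J mu : uniq J ->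
  \sum_(s < N.+1) (-1) ^+ s * 'C(N, s)%:R *
     letter_op (b, p - s%:Z) (letter_op (a, m + s%:Z) g) J mu
  = \sum_(i <- J | col i == b) \sum_(j <- rem i J | col j == a)
      sgn2 J i j * hsum2 g J mu (p + rho J mu i - N%:Z) (m + rho J mu j) i j.
Proof.
move=> uJ; pose R i := (absz (p + rho J mu i - N%:Z)%R).+1.
under eq_bigr => s _.
  rewrite (@letter_op_comp _ _ _ _ _ (fun i => (R i).+1)) //=; last by move=> i; rewrite /R; lia.
  rewrite mulr_sumr; under eq_bigr do rewrite mulr_sumr.
  over.
rewrite exchange_big; apply: eq_bigr => i _ /=.
rewrite exchange_big; apply: eq_bigr => j _ /=.
pose F (l : nat) := hsum2 g J mu (p + rho J mu i - N%:Z - l%:Z) (m + rho J mu j + l%:Z) i j.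
transitivity (sgn2 J i j * F 0); last by rewrite /F subr0 addr0.
rewrite -(@wt_inv k N (R i) F) => [|l lR]; last by apply: hsum2_lt0; rewrite /R in lR; lia.
rewrite mulr_sumr; apply: eq_bigr => s _; rewrite mulrCA; congr (_ * (_ * _)).
apply: eq_bigr => e _; congr (_ * _).
by rewrite /F; congr (hsum2 _ _ _ _ _ _ _); rewrite PoszD; lia.
Qed.

(** Reversing the second sum by s -> N - s costs (-1)^N. Without the pole the coefficients do not
    depend on which variable is taken first, and the orientation of z_i - z_j accounts for the same
    sign. *)
Lemma letter_op_locality b a (p m : int) g J mu :
  \sum_(s < N.+1) (-1) ^+ s * 'C(N, s)%:R *
     (letter_op (b, p - s%:Z) (letter_op (a, m + s%:Z) g) J mu
      - letter_op (a, m + s%:Z) (letter_op (b, p - s%:Z) g) J mu) = 0.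
Proof.
case uJ: (uniq J); last first.
  by rewrite big1 // => s _; rewrite /letter_op uJ subrr mulr0.
under eq_bigr do rewrite mulrBr.
rewrite sumrB letter_op_signed_sum // [X in _ - X](reindex_inj rev_ord_inj) /=.
rewrite [X in _ - X](_ : _ = (-1) ^+ N * \sum_(s < N.+1) (-1) ^+ s * 'C(N, s)%:R *
     letter_op (a, (m + N%:Z) - s%:Z) (letter_op (b, (p - N%:Z) + s%:Z) g) J mu); last first.
  rewrite mulr_sumr; apply: eq_bigr => -[s] /=; rewrite ltnS => sN _.
  rewrite subSS bin_sub // !mulrA; congr (_ * _ * _).
    rewrite -{2}(subnK sN) exprD -mulrA -exprD addnn -mul2n exprM sqrrN !expr1n.
    by rewrite mulr1.
  by congr (letter_op (_, _) (letter_op (_, _) _) _ _); lia.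
rewrite letter_op_signed_sum // exchange_big_rem mulr_sumr -sumrB.
rewrite big_seq_cond big1 // => i /andP[iJ _].
rewrite mulr_sumr -sumrB big_seq_cond big1 // => j /andP[jJ _].
have ij : i != j by apply: contraTneq jJ => ->; rewrite mem_rem_uniqF.
rewrite hsum2C /sgn2 (sgn1C ij) remC mulrA.
rewrite (_ : m + N%:Z + rho J mu i - N%:Z = m + rho J mu i); last by lia.
rewrite (_ : p - N%:Z + rho J mu j = p + rho J mu j - N%:Z); last by lia.
ring.
Qed.

End Model.

(** * Words and leading monomials *)

Section Words.
Variables (d : Order.disp_t) (B : orderType d) (N : nat).
Implicit Types (w : seq (B * int)) (p q : int * B).

(* The sum of the partial sums, hence strictly monotone for the dominance order. *)
Fixpoint wsum (s : seq int) : int :=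
  if s is x :: s' then x * (size s)%:Z + wsum s' else 0.

Lemma wsum_map_addr (T : Type) (f g : T -> int) (s : seq T) :
  wsum [seq f x + g x | x <- s] = wsum (map f s) + wsum (map g s).
Proof. by elim: s => //= x s ->; rewrite !size_map mulrDl; lia. Qed.

Lemma wsum_nat_le (T : Type) (c : T -> nat) (s : seq T) :
  wsum [seq (c x)%:Z | x <- s] <= (size s * \sum_(x <- s) c x)%:Z.
Proof. by elim: s => [|x s IH] //=; rewrite big_cons size_map; nia. Qed.

Lemma wsum_rot (x : int) (s1 s2 : seq int) : all (<= x) s1 ->
  wsum (s1 ++ x :: s2) <= wsum (x :: s1 ++ s2).
Proof.
elim: s1 => //= y s1 IH /andP[yx /IH]; rewrite /= !size_cat /=; nia.
Qed.

(** Earlier entries weigh more, so moving the maximum to the front never lowers [wsum]; the rest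
    follows by induction. *)
Lemma wsum_sorted (s t : seq int) : perm_eq s t -> sorted >=%O t -> wsum s <= wsum t.
Proof.
elim: t s => [|x t IH] s; first by move=> /perm_nilP ->.
move=> st /[dup] /path_sorted ts; rewrite /= path_sortedE; last exact/rev_trans/le_trans.
move=> /andP[tx _]; have /splitPr xs : x \in s by rewrite (perm_mem st) mem_head.
case: xs st => s1 s2; rewrite -cat1s perm_catCA cat1s perm_cons => st.
apply: (le_trans (wsum_rot _ _)).
  apply/allP => y ys; apply: (allP tx); rewrite -(perm_mem st) mem_cat ys //.
by rewrite /= (perm_size st) lerD2l IH.
Qed.

(* The leading coefficient of the expansion of z^mu \prod_(i < j) (z_i - z_j)^-N in
   |z_1| > ... > |z_k| is the one with mu_i = N (k - i) - 1 - n_i. *)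
Fixpoint code w : seq (int * B) :=
  if w is x :: w' then ((N * size w')%:Z - 1 - x.2, x.1) :: code w' else [::].

Lemma size_code w : size (code w) = size w.
Proof. by elim: w => //= x w ->. Qed.

Lemma code_inj : injective code.
Proof.
elim=> [|[a m] w IH] [|[b p] w'] //= [e1 -> e2].
by rewrite (IH _ e2) in e1 *; congr ((_, _) :: _); lia.
Qed.

Definition code_le p q : bool := (q.1 < p.1) || (p.1 == q.1) && (p.2 <= q.2)%O.
Definition code_lt p q : bool := (q.1 < p.1) || (p.1 == q.1) && (p.2 < q.2)%O.

Lemma code_le_anti : antisymmetric code_le.
Proof.
move=> [m a] [p b]; rewrite /code_le /=; case: (ltgtP m p) => //= ->.
by move=> /le_anti ->.
Qed.

Lemma code_le_trans : transitive code_le.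
Proof.
move=> [p b] [m a] [q c]; rewrite /code_le /=.
case: (ltgtP m p) => //= [pm _|-> ab].
  case: (ltgtP p q) => //= [qp _|e _]; first by rewrite (lt_trans qp pm).
  by rewrite -e pm.
by case: (ltgtP p q) => //= _; apply: le_trans.
Qed.

Lemma code_lt_trans : transitive code_lt.
Proof.
move=> [p b] [m a] [q c]; rewrite /code_lt /=.
case: (ltgtP m p) => //= [pm _|-> ab].
  case: (ltgtP p q) => //= [qp _|e _]; first by rewrite (lt_trans qp pm).
  by rewrite -e pm.
by case: (ltgtP p q) => //= _; apply: lt_trans.
Qed.

(** Consecutive code exponents differ by N - (n_i - n_(i+1)). Admissibility thus says that they
    decrease weakly, and that colours increase along ties, strictly when [N] is odd. *)
Lemma admissible_code w :
  admissible N w = sorted (if odd N then code_lt else code_le) (code w).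
Proof.
case: w => //= x w; elim: w x => //= y w IH x; rewrite IH; congr (_ && _).
rewrite /admissible_pair; set m := (N * size w)%:Z.
have -> : (N * (size w).+1)%:Z = N%:Z + m :> int by rewrite mulnS PoszD.
by case: (odd N); rewrite /code_lt /code_le /=; case: (ltgtP x.1 y.1) => _ /=; lia.
Qed.

Lemma admissible_sorted w : admissible N w -> sorted code_le (code w).
Proof.
rewrite admissible_code; case: (odd N) => //; apply: sub_sorted => p q.
by rewrite /code_lt /code_le => /orP[->|/andP[-> /ltW ->]] //; rewrite orbT.
Qed.

Lemma admissible_uniq w : odd N -> admissible N w -> uniq (code w).
Proof.
move=> oN; rewrite admissible_code oN; apply: sorted_uniq code_lt_trans _ _.
by move=> p; rewrite /code_lt !ltxx andbF.
Qed.

Lemma code_sorted_fst w : sorted code_le (code w) -> sorted >=%O (map fst (code w)).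
Proof.
rewrite sorted_map; apply: sub_sorted => p q /=.
by rewrite /code_le => /orP[/ltW //|/andP[/eqP <-]].
Qed.

(** The last code exponent is -1 - n_k, and by sortedness it is the smallest. *)
Lemma last_neg_code w : sorted code_le (code w) ->
  last_neg w = all (fun p => 0 <= p.1) (code w).
Proof.
elim: w => //= x [|y w] IH; first by move=> _ /=; rewrite muln0 andbT; lia.
move=> /andP[xy /IH /= ->]; apply/idP/idP => [a|/andP[] //]; rewrite a andbT.
by move: xy a; rewrite /code_le /= => xy /andP[]; case/orP: xy => [|/andP[/eqP]]; lia.
Qed.

End Words.

(** * Nonzero coefficients of words and dominance of exponents *)

Section WordVectors.
Variables (k : fieldType) (d : Order.disp_t) (B : orderType d) (N n : nat).
Variable col : 'I_n -> B.
Notation I := 'I_n.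
Notation op := (@letter_op k N n B col).
Notation hsum := (@hsum k N n).
Implicit Types (w : seq (B * int)) (J : seq I) (mu nu : I -> int).

Definition vac : seq I -> (I -> int) -> k^o := fun J _ => (J == [::])%:R.

Definition word_vec w := foldr op vac w.

Lemma hsum0 J h mu : hsum J 0 h mu = h mu.
Proof.
elim: J mu => [|i J IH] mu /=; first by rewrite mul1r.
by rewrite big_ord1 wt0 mul1r subr0 IH shift0.
Qed.

(** A nonzero sum has a nonzero term; [c] records the shift of each variable in it. *)
Lemma hsum_neq0 J r h mu : uniq J -> hsum J r h mu <> 0 ->
  exists c : I -> nat, [/\ forall i, i \notin J -> c i = 0%N,
    r = (\sum_(i <- J) c i)%:Z & h (fun i => mu i + (c i)%:Z) <> 0].
Proof.
elim: J r mu => [|i J IH] r mu /=.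
  move=> _; case: eqP => [->|_] hn0; last by rewrite mul0r in hn0.
  exists (fun=> 0%N); rewrite big_nil; split=> //.
  rewrite mul1r in hn0; rewrite (_ : (fun _ => _) = mu) //.
  by apply/funext => l; rewrite addr0.
move=> /andP[iJ uJ] hn0.
have [/forallP e0|] := boolP [forall e : 'I_(absz r).+1,
    hsum J (r - e%:Z) h (shift i e mu) == 0].
  by case: hn0; rewrite big1 // => e _; rewrite (eqP (e0 e)) mulr0.
rewrite negb_forall => /existsP[e /eqP /(IH _ _ uJ)[c [c0 rc hc]]].
exists (fun l => c l + (e : nat) * (l == i))%N; split.
- by move=> l; rewrite inE negb_or => /andP[/negbTE -> /c0 ->]; rewrite muln0.
- rewrite big_cons eqxx muln1 c0 // add0n big_split /= PoszD.
  rewrite [X in _ + (_ + X)%N%:Z]big1_seq => [|l /= lJ]; first by lia.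
  by rewrite (_ : l == i = false) ?muln0 //; apply: contraNF iJ => /eqP <-.
- move: hc; congr (h _ <> 0); apply/funext => l; rewrite /shift PoszD; lia.
Qed.

Lemma word_vec_cons_neq0 x w J mu : uniq J -> word_vec (x :: w) J mu <> 0 ->
  exists i, [/\ i \in J, col i = x.1 &
    hsum (rem i J) (x.2 + 1 + mu i - (N * (size J).-1)%:Z)
      (word_vec w (rem i J)) (reset i mu) <> 0].
Proof.
move=> uJ; rewrite /= {1}/letter_op uJ => s0.
have [/allP all0|/allPn[i iJ]] := boolP (all (fun i => (col i == x.1) ==>
  (hsum (rem i J) (x.2 + 1 + mu i - (N * (size J).-1)%:Z)
      (word_vec w (rem i J)) (reset i mu) == 0)) J).
  case: s0; rewrite big_seq_cond big1 // => i /andP[/all0 /implyP iJ /iJ /eqP].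
  by rewrite /word_vec => ->; rewrite mulr0.
by rewrite negb_imply => /andP[/eqP ci /eqP hi]; exists i.
Qed.

(** [l] lists the variables in the order in which the letters remove them. Each expansion only moves
    degree from the removed variable to later ones, which gives dominance. *)
Lemma word_vec_neq0 w J mu : uniq J -> word_vec w J mu <> 0 ->
  exists l : seq I, [/\ perm_eq l J, map col l = map fst w,
    wsum (map fst (code N w)) <= wsum (map mu l) &
    wsum (map fst (code N w)) = wsum (map mu l) -> map fst (code N w) = map mu l].
Proof.
elim: w J mu => [|x w IH] J mu uJ.
  rewrite /word_vec /= /vac; case: eqP => // -> _.
  by exists [::].
move=> /(word_vec_cons_neq0 uJ)[i [iJ ci]].
have uiJ := rem_uniq i uJ; move=> /(hsum_neq0 uiJ)[c [c0 rc]].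
move=> /(IH _ _ uiJ)[l [lJ cl le eq]].
have il : i \notin l by rewrite (perm_mem lJ) mem_rem_uniqF.
have mul : [seq reset i mu j + (c j)%:Z | j <- l] = [seq mu j + (c j)%:Z | j <- l].
  apply/eq_in_map => j jl; rewrite /reset (_ : j == i = false) //.
  by apply: contraNF il => /eqP <-.
rewrite {}mul in le eq.
have sz : size l = size w by rewrite -(size_map col) cl size_map.
have szJ : (size J).-1 = size w by rewrite -(size_rem iJ) -(perm_size lJ).
move eS: (\sum_(j <- rem i J) c j)%N rc => S; rewrite szJ => rc.
have em : (N * size w)%:Z - 1 - x.2 = mu i - S%:Z by lia.
move: le eq; rewrite wsum_map_addr => le eq.
(* Taking [S] off the first entry costs (size w + 1) * S in [wsum], and the later entries regain at
   most size w * S; hence equality forces [S] = 0. *)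
have le1 := wsum_nat_le c l; rewrite (perm_big _ lJ) /= eS sz in le1.
exists (i :: l); split=> /=; rewrite ?size_map ?size_code ?sz ?em; last 2 first.
- by move: le le1; clear; nia.
- move=> e; have s0 : S = 0%N by move: e le le1; clear; nia.
  have cl0 : [seq mu j + (c j)%:Z | j <- l] = map mu l.
    apply/eq_in_map => j; rewrite (perm_mem lJ) => jJ.
    by move: eS; rewrite s0 (big_rem j jJ) /=; case: (c j) => //; rewrite addr0.
  rewrite cl0 in eq; rewrite s0 subr0 eq //.
  by move: e le le1; rewrite s0 muln0 subr0; lia.
- by rewrite (perm_trans _ (_ : perm_eq (i :: rem i J) J)) ?perm_cons // perm_sym perm_to_rem.
- by rewrite ci cl.
Qed.

(** Shifts only raise exponents, so the last variable keeps an exponent mu >= 0. With no variable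
    left to absorb degree, the last letter must have n = -1 - mu. *)
Lemma word_vec_last_neg w J mu : uniq J -> {in J, forall i, 0 <= mu i} ->
  word_vec w J mu <> 0 -> last_neg w.
Proof.
elim: w J mu => [|x w IH] J mu uJ mu0 //.
move=> /(word_vec_cons_neq0 uJ)[i [iJ ci]].
have uiJ := rem_uniq i uJ; move=> /(hsum_neq0 uiJ)[c [c0 rc hc]].
case: w IH hc => [_|y w IH hc] /=; last first.
  apply: (IH _ _ uiJ _ hc) => j; rewrite mem_rem_uniq // !inE => /andP[ji jJ].
  by rewrite /reset (negbTE ji) addr_ge0 ?mu0.
rewrite /word_vec /= /vac; case: eqP => // rJ _.
have := size_rem iJ; rewrite rJ /= => s0.
move: rc; rewrite rJ big_nil -s0 muln0; have := mu0 i iJ; lia.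
Qed.

End WordVectors.

(** * Functionals on the enveloping algebra *)

Section Diagonal.
Variables (k : fieldType) (d : Order.disp_t) (B : orderType d) (N n : nat).
Variable col : 'I_n -> B.
Notation I := 'I_n.
Notation wvec := (@word_vec k d B N n col).
Notation sgn := (@order_sign k N n).
Implicit Types (w : seq (B * int)) (J : seq I) (mu nu : I -> int).

Definition label mu (i : I) : int * B := (mu i, col i).

Lemma label_reset mu i J : i \notin J -> map (label (reset i mu)) J = map (label mu) J.
Proof.
move=> iJ; apply/eq_in_map => j jJ; rewrite /label /reset (_ : j == i = false) //.
by apply: contraNF iJ => /eqP <-.
Qed.

Lemma perm_label_rem mu i J p s : i \in J -> uniq J -> label mu i = p ->
  perm_eq (map (label mu) J) (p :: s) ->
  perm_eq (map (label (reset i mu)) (rem i J)) s.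
Proof.
move=> iJ uJ <-; rewrite (permPl (perm_map _ (perm_to_rem iJ))) /= perm_cons.
by rewrite label_reset // mem_rem_uniqF.
Qed.

Lemma word_vec_diag x w J mu : uniq J -> sorted (@code_le _ _) (code N (x :: w)) ->
  perm_eq (map (label mu) J) (code N (x :: w)) ->
  wvec (x :: w) J mu =
  \sum_(i <- J | label mu i == head (0, x.1) (code N (x :: w)))
     sgn i (rem i J) * wvec w (rem i J) (reset i mu).
Proof.
move=> uJ /code_sorted_fst /=; rewrite path_sortedE; last exact/rev_trans/le_trans.
move=> /andP[mmax _] pJ.
have szJ : (size J).-1 = size w by rewrite -(size_map (label mu)) (perm_size pJ) /= size_code.
have mle i : i \in J -> mu i <= (N * size w)%:Z - 1 - x.2.
  move=> iJ; have : label mu i \in map (label mu) J by apply: map_f.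
  rewrite (perm_mem pJ) inE => /orP[/eqP[-> _] //|/(map_f fst) /= iw].
  exact: (allP mmax).
rewrite /= /letter_op uJ big_mkcond [RHS]big_mkcond big_seq [RHS]big_seq.
apply: eq_bigr => i iJ; rewrite /label xpair_eqE andbC szJ.
case: (col i == x.1) => //=; have := mle i iJ; case: ltgtP => // [lt _|-> _].
  by rewrite hsum_lt0 ?mulr0 //; lia.
by rewrite (_ : _ - _ = 0) ?hsum0 //; lia.
Qed.

Lemma sgn_even i J : ~~ odd N -> sgn i J = 1.
Proof.
move=> eN; rewrite /order_sign big1 // => l _; rewrite /sgn1.
by rewrite -signr_odd oddM (negbTE eN).
Qed.

Lemma sgn_sign i J : exists e : nat, sgn i J = (-1) ^+ e.
Proof.
rewrite /order_sign; elim: J => [|l J [e IH]]; first by exists 0%N; rewrite big_nil.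
by exists (N * (l < i) + e)%N; rewrite big_cons IH exprD.
Qed.

(** All signs are 1, so the value counts the orderings of [J] whose labels spell the code, and one
    exists. The form [p.+1] makes it nonzero in characteristic 0. *)
Lemma word_vec_diag_even w J mu : ~~ odd N -> uniq J -> sorted (@code_le _ _) (code N w) ->
  perm_eq (map (label mu) J) (code N w) -> exists p : nat, wvec w J mu = p.+1%:R.
Proof.
move=> eN; elim: w J mu => [|x w IH] J mu uJ sw pJ.
  exists 0%N; rewrite /word_vec /= /vac.
  by move/perm_size: pJ; rewrite size_map => /size0nil ->.
rewrite word_vec_diag //.
have IH' i : i \in J -> label mu i = head (0, x.1) (code N (x :: w)) ->
    exists p : nat, wvec w (rem i J) (reset i mu) = p.+1%:R.
  move=> iJ li; apply: IH; rewrite ?rem_uniq //; first exact: path_sorted sw.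
  exact: perm_label_rem li pJ.
have /mapP[i iJ /esym li] : head (0, x.1) (code N (x :: w)) \in map (label mu) J.
  by rewrite (perm_mem pJ) mem_head.
rewrite (big_rem i iJ) /= li eqxx sgn_even // mul1r.
have [p ->] := IH' i iJ li.
have [q ->] : exists q : nat, \sum_(j <- rem i J | label mu j == head (0, x.1) (code N (x :: w)))
     sgn j (rem j J) * wvec w (rem j J) (reset j mu) = q%:R.
  have sub : {subset rem i J <= J} by apply: mem_rem.
  elim: (rem i J) sub => [|j s IHs] sub; first by exists 0%N; rewrite big_nil.
  have [|q qE] := IHs; first by move=> l ls; apply: sub; rewrite inE ls orbT.
  rewrite big_cons qE; case: eqP => [lj|_]; last by exists q.
  have [p' ->] := IH' j (sub j (mem_head _ _)) lj.
  by exists (p'.+1 + q)%N; rewrite sgn_even // mul1r natrD.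
by exists (p + q)%N; rewrite -natrD.
Qed.

(** Distinct labels leave exactly one variable for each letter, so a single sign survives. *)
Lemma word_vec_diag_odd w J mu : uniq (code N w) -> uniq J -> sorted (@code_le _ _) (code N w) ->
  perm_eq (map (label mu) J) (code N w) -> exists e : nat, wvec w J mu = (-1) ^+ e.
Proof.
elim: w J mu => [|x w IH] J mu uw uJ sw pJ.
  exists 0%N; rewrite /word_vec /= /vac.
  by move/perm_size: pJ; rewrite size_map => /size0nil ->.
rewrite word_vec_diag //.
have /mapP[i iJ /esym li] : head (0, x.1) (code N (x :: w)) \in map (label mu) J.
  by rewrite (perm_mem pJ) mem_head.
have [/= _ uw'] := andP uw.
have [e eE] : exists e : nat, wvec w (rem i J) (reset i mu) = (-1) ^+ e.
  apply: IH; rewrite ?rem_uniq //; first exact: path_sorted sw.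
  exact: perm_label_rem li pJ.
have [e' e'E] := sgn_sign i (rem i J).
exists (e' + e)%N; rewrite (big_rem i iJ) /= li eqxx eE e'E -exprD.
rewrite big1_seq ?addr0 // => j /andP[/eqP lj jJ].
have : uniq (map (label mu) J) by rewrite (perm_uniq pJ).
rewrite (perm_uniq (perm_map _ (perm_to_rem iJ))) /= => /andP[/negP[]].
by apply/mapP; exists j; rewrite // li lj.
Qed.

End Diagonal.

(** * The action of the enveloping algebra by letter operators *)

Section Representation.
Variables (k : fieldType) (d : Order.disp_t) (B : orderType d) (N n : nat).
Variable col : 'I_n -> B.
Notation I := 'I_n.
Notation M := (seq I -> (I -> int) -> k^o).
Notation op := (@letter_op k N n B col).

Lemma vac_neq0 : exists v : M, v != 0.
Proof.
exists (@vac k n); apply/eqP => /(congr1 (fun g : M => g [::] (fun=> 0))) /eqP.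
by rewrite /vac /= oner_eq0.
Qed.

Lemma letter_op_linear x : linear (op x : M -> M).
Proof.
move=> c g h; apply/funext => J; apply/funext => mu.
rewrite !fctE /letter_op; case: uniq; last by rewrite scaler0 addr0.
rewrite scaler_sumr -big_split /=; apply: eq_bigr => i _.
set J' := rem i J; set r := (_ - _ : int).
(* Linearity in [g] is [hsum_lin] for a two-term sum indexed by [bool]. *)
have := @hsum_lin k N n J' r bool [:: true; false] xpredT
  (fun b => if b then c else 1) (fun b => if b then g J' else h J') (reset i mu).
rewrite !big_cons !big_nil !addr0 mul1r => hE.
transitivity (@order_sign k N n i J' * (c * hsum N J' r (g J') (reset i mu)
    + hsum N J' r (h J') (reset i mu))); last by rewrite mulrDr mulrCA.
rewrite -hE; congr (_ * _); apply: hsum_eq => nu.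
by rewrite !big_cons big_nil addr0 mul1r.
Qed.

Notation E := (lend vac_neq0).

Lemma letter_op_linear_pred x : (op x : M -> M) \in @linear_pred k M.
Proof. exact/asboolP/letter_op_linear. Qed.

Definition lend_op x : E := Lend vac_neq0 (letter_op_linear_pred x).

Lemma lend_op_locality b a (p m : int) :
  \sum_(s < N.+1) ((-1) ^+ s * 'C(N, s)%:R) *:
    (lend_op (b, p - s%:Z) * lend_op (a, m + s%:Z) - lend_op (a, m + s%:Z) * lend_op (b, p - s%:Z)) = 0.
Proof.
apply: lend_eqP => g; rewrite lend_sumE; apply/funext => J; apply/funext => mu.
by rewrite !fct_sumE -[RHS](letter_op_locality N col b a p m g J mu).
Qed.

Lemma lie_eval_locality (L : lieAlgType k) (f : B * int -> L) (a b : B) (m p : int) :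
  lie_eval f (locality_term k N a b m p) =
  \sum_(s < N.+1) ((-1) ^+ s * 'C(N, s)%:R) *: lie (f (b, p - s%:Z)) (f (a, m + s%:Z)).
Proof. by rewrite /locality_term (big_morph (lie_eval f) (id1 := 0) (op1 := +%R)). Qed.

Lemma exists_representation :
  exists F : {lrmorphism uea (coeffL k B N) -> E},
    forall b p, F (uea_in (gen k N b p)) = lend_op (b, p).
Proof.
have rel t : @locality_rel k B N t -> lie_eval (lend_op : _ -> comm_lie E) t = 0.
  by move=> [a [b [m [p ->]]]]; rewrite lie_eval_locality; apply: lend_op_locality.
have [f [flin flie fgen]] := pres_lie_universal rel.
have [F FE] := @uea_universal k (coeffL k B N) E f flin flie.
by exists F => b p; rewrite FE; apply: fgen.
Qed.

End Representation.

Section WordFunctional.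
Variables (k : fieldType) (hk : [pchar k] =i pred0).
Variables (d : Order.disp_t) (B : orderType d) (N : nat).
Implicit Types (w : seq (B * int)) (u : uea (coeffL k B N)).

(** The variables attached to [w] are its positions, coloured by its letters; [word_exp] gives them
    the code exponents, so that [w] labels its own functional. *)
Definition word_col w (i : 'I_(size w)) : B := (tnth (in_tuple w) i).1.
Definition word_exp w (i : 'I_(size w)) : int := nth 0 (map fst (code N w)) i.

Lemma map_word_col w : map (@word_col w) (enum 'I_(size w)) = map fst w.
Proof. by rewrite /word_col map_comp map_tnth_enum. Qed.

Lemma map_word_exp w : map (@word_exp w) (enum 'I_(size w)) = map fst (code N w).
Proof.
rewrite /word_exp (map_comp (nth 0 _) val) val_enum_ord.
by rewrite -{2}[map fst _](mkseq_nth 0) size_map size_code.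
Qed.

Lemma map_word_label w l : map (label (@word_col w) (@word_exp w)) l =
  zip (map (@word_exp w) l) (map (@word_col w) l).
Proof. by elim: l => //= i l ->. Qed.

Lemma zip_code w : zip (map fst (code N w)) (map fst w) = code N w.
Proof. by elim: w => //= x w ->. Qed.

Definition word_fun w w' : k :=
  word_vec k N (@word_col w) w' (enum 'I_(size w)) (@word_exp w).

Lemma exists_word_functional w :
  exists phi : {linear uea (coeffL k B N) -> k^o},
    forall w', phi (U_monomial k N w') = word_fun w w'.
Proof.
have [F FE] := exists_representation k N (@word_col w).
pose phi u : k^o := F u (@vac k _) (enum 'I_(size w)) (@word_exp w).
have phil : linear phi.
  move=> c u v; have FL : F (c *: u + v) = c *: F u + F v by exact: linearP.
  by rewrite /phi FL lend_addE lend_scaleE.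
pose FF : {linear uea (coeffL k B N) -> k^o} :=
  HB.pack phi (GRing.isLinear.Build k (uea (coeffL k B N)) k^o _ phi phil).
exists FF => w' /=; rewrite /phi /word_fun; congr (_ _ _); rewrite /U_monomial.
elim: w' => [|x w' IH]; first by rewrite big_nil rmorph1.
by rewrite big_cons rmorphM /= IH FE; case: x.
Qed.

Lemma word_fun_diag w : admissible N w -> word_fun w w != 0.
Proof.
move=> aw; have pw : perm_eq (map (label (@word_col w) (@word_exp w)) (enum 'I_(size w)))
    (code N w).
  by rewrite map_word_label map_word_col map_word_exp zip_code.
have sw := admissible_sorted aw; rewrite /word_fun.
case oN: (odd N).
  have [e ->] := word_vec_diag_odd k (admissible_uniq oN aw) (enum_uniq _) sw pw.
  by rewrite signr_eq0.
have [p ->] := word_vec_diag_even k (negbT oN) (enum_uniq _) sw pw.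
by move/pcharf0P: hk => ->.
Qed.

(** The code exponents of [w'] are dominated by a rearrangement of those of [w], hence by the sorted
    one. In case of equality both codes are sorted listings of the same labels, and [code] is
    injective. *)
Lemma word_fun_triangular w w' : admissible N w -> admissible N w' -> word_fun w w' != 0 ->
  w' = w \/ wsum (map fst (code N w')) < wsum (map fst (code N w)).
Proof.
move=> aw aw' /eqP /(word_vec_neq0 (enum_uniq _))[l [pl cl le eq]].
have sw := admissible_sorted aw; have sw' := admissible_sorted aw'.
have pe : perm_eq (map (@word_exp w) l) (map fst (code N w)).
  by rewrite -map_word_exp perm_map.
have := le_trans le (wsum_sorted pe (code_sorted_fst sw)).
rewrite le_eqVlt => /predU1P[e|]; [left | by right].
apply: (@code_inj _ B N); apply: (sorted_eq (@code_le_trans _ B) (@code_le_anti _ B)) => //.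
have ec : map fst (code N w') = map (@word_exp w) l.
  by apply: eq; apply/eqP; rewrite eq_le le e wsum_sorted // code_sorted_fst.
rewrite -[code N w']zip_code -[code N w]zip_code ec -cl.
by rewrite -map_word_exp -map_word_col -!map_word_label perm_map.
Qed.

Lemma word_fun_last_neg w w' : admissible N w -> last_neg w -> word_fun w w' != 0 -> last_neg w'.
Proof.
move=> aw nw /eqP; apply: word_vec_last_neg; first exact: enum_uniq.
move=> i _; have : word_exp i \in map fst (code N w) by rewrite -map_word_exp map_f ?mem_enum.
by rewrite (last_neg_code (admissible_sorted aw)) in nw => /mapP[p /(allP nw) ? ->].
Qed.

(** The hypothesis speaks of functionals because in V a combination vanishes only modulo a left
    ideal, which the functionals of [last_neg] words kill. *)
Lemma admissible_free (s : seq (seq (B * int))) (c : seq (B * int) -> k) (P : pred (seq (B * int))) :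
  uniq s -> all P s -> (forall w, P w -> admissible N w) ->
  (forall (phi : {linear uea (coeffL k B N) -> k^o}) w, P w ->
     (forall w', phi (U_monomial k N w') = word_fun w w') ->
     phi (\sum_(w <- s) c w *: U_monomial k N w) = 0) ->
  forall w, w \in s -> c w = 0.
Proof.
move=> us sP Padm s0.
have /cid[phi phiE] : exists phi : seq (B * int) -> {linear uea (coeffL k B N) -> k^o},
    forall w w', phi w (U_monomial k N w') = word_fun w w'.
  by exists (fun w => sval (cid (exists_word_functional w))) => w; case: cid.
apply: (@triangular_free k _ _ P (U_monomial k N) (fun w => wsum (map fst (code N w)))
   (fun w u => phi w u)) => //.
- by move=> w a x y; rewrite linearP.
- by move=> w Pw; rewrite phiE word_fun_diag ?Padm.
- by move=> w w' Pw Pw'; rewrite phiE; apply: word_fun_triangular; apply: Padm.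
- by move=> w Pw; apply: (s0 _ w).
Qed.

End WordFunctional.

(** * Rewriting *)

Section Spans.
Variables (k : fieldType) (A : algType k).

Lemma lspan_lspan (M : lmodType k) (S T : M -> Prop) (x : M) :
  (forall y, S y -> lspan T y) -> lspan S x -> lspan T x.
Proof.
by move=> ST [n [a [v [Sv ->]]]]; apply: lspan_sum => i _; apply/lspanZ/ST.
Qed.

Lemma lspan_image (M M' : lmodType k) (f : {linear M -> M'}) (S : M -> Prop) (T : M' -> Prop) (x : M) :
  (forall y, S y -> lspan T (f y)) -> lspan S x -> lspan T (f x).
Proof.
move=> ST [n [a [v [Sv ->]]]]; rewrite linear_sum; apply: lspan_sum => i _.
by rewrite linearZ; apply/lspanZ/ST.
Qed.

Lemma lspan_mul (S T R : A -> Prop) (x y : A) :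
  (forall x' y', S x' -> T y' -> R (x' * y')) -> lspan S x -> lspan T y -> lspan R (x * y).
Proof.
move=> STR [m [a [v [Sv ->]]]] [n [b [w [Tw ->]]]].
rewrite mulr_suml; apply: lspan_sum => i _; rewrite mulr_sumr; apply: lspan_sum => j _.
by rewrite -scalerAl -scalerAr; do 2!apply: lspanZ; apply/lspan_gen/STR.
Qed.

(** A coefficient function allows one coefficient per index, so the coefficients of repeated indices
    are first added up. *)
Lemma lspan_family (M : lmodType k) (I : eqType) (P : pred I) (v : I -> M) (x : M) :
  lspan (fun z => exists2 i, P i & z = v i) x ->
  exists (s : seq I) (c : I -> k), all P s /\ x = \sum_(i <- s) c i *: v i.
Proof.
case=> n [a [u [Su ->]]].
have /choice[f fP] : forall i, exists j, P j /\ u i = v j.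
  by move=> i; have [j Pj uj] := Su i; exists j.
exists (undup [seq f i | i <- enum 'I_n]), (fun j => \sum_(i | f i == j) a i).
split; first by apply/allP => j; rewrite mem_undup => /mapP[i _ ->]; case: (fP i).
under [RHS]eq_bigr do rewrite scaler_suml big_mkcond.
rewrite exchange_big; apply: eq_bigr => i _ /=.
rewrite (bigD1_seq (f i)) /=; last exact: undup_uniq; last first.
  by rewrite mem_undup map_f ?mem_enum.
rewrite eqxx big1 ?addr0 => [|j]; first by case: (fP i) => _ ->.
by rewrite eq_sym => /negbTE ->.
Qed.
End Spans.

Lemma nsortedP (T : Type) (r : rel T) (w : seq T) : ~~ sorted r w ->
  exists u x y v, w = u ++ x :: y :: v /\ ~~ r x y.
Proof.
case: w => // x w; elim: w x => //= y w IH x; rewrite negb_and.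
case: (boolP (r x y)) => /= [_ /IH|rxy _]; last by exists [::], x, y, w.
by move=> [u [x' [y' [v [-> rxy]]]]]; exists (x :: u), x', y', v.
Qed.

Section Inversions.
Variables (d : Order.disp_t) (B : orderType d).

Fixpoint inversions (s : seq B) : nat :=
  if s is x :: s' then count (fun y => (y < x)%O) s' + inversions s' else 0%N.

Lemma inversions_swap (s t : seq B) (a b : B) : (a < b)%O ->
  (inversions (s ++ a :: b :: t) < inversions (s ++ b :: a :: t))%N.
Proof.
move=> ab; elim: s => [|x s IH] /=; last by rewrite !count_cat /=; lia.
by rewrite ab ltNge ltW //=; lia.
Qed.

End Inversions.

(** Neighbouring positions have consecutive weights, so at fixed sum [wsum] changes by x' - x. *)
Lemma wsum_replace (s t : seq int) (x y x' y' : int) : x' + y' = x + y ->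
  wsum (s ++ x' :: y' :: t) + x = wsum (s ++ x :: y :: t) + x'.
Proof.
move=> xy; elim: s => [|z s IH] /=; last by rewrite !size_cat /=; lia.
rewrite (_ : y' = x + y - x'); last by lia.
by rewrite !intS; ring.
Qed.

Section Straightening.
Variables (k : fieldType) (hk : [pchar k] =i pred0) (A : algType k).
Variables (d : Order.disp_t) (B : orderType d) (N : nat).
Variables (e : B * int -> A) (lo : int).
(** In this range every exponent that occurs is at least [lo]. So the rewriting also applies to
    U(L_+) with [lo] = 0, where letters of negative exponent do not exist. *)
Hypothesis locality : forall (a b : B) (m p : int), lo <= m -> m + N%:Z <= p ->
  \sum_(s < N.+1) ((-1) ^+ s * 'C(N, s)%:R) *:
    (e (b, p - s%:Z) * e (a, m + s%:Z) - e (a, m + s%:Z) * e (b, p - s%:Z)) = 0.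
Implicit Types (x y : B * int) (u v w : seq (B * int)).

Definition pair_lt x' y' x y : Prop := [/\ lo <= x'.2, lo <= y'.2, x'.2 + y'.2 = x.2 + y.2 &
  x'.2 < x.2 \/ [/\ x'.2 = x.2, x'.1 = y.1, y'.1 = x.1 & (y.1 < x.1)%O]].

(** Locality is solved for its first term. All other terms have first exponent below [p], except a(m
    + N) b(p - N) when p = m + N. *)
Lemma straighten_pair x y : lo <= y.2 -> ~~ admissible_pair N x y ->
  lspan (fun z => exists x' y', pair_lt x' y' x y /\ z = e x' * e y') (e x * e y).
Proof.
case: x y => [b p] [a m] /= lom adm; set L := lspan _.
have mp : m + N%:Z <= p by move: adm; rewrite /admissible_pair /=; case: ifP; lia.
pose c s : k := (-1) ^+ s * 'C(N, s)%:R.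
pose P (s : nat) := e (b, p - s%:Z) * e (a, m + s%:Z).
pose Q (s : nat) := e (a, m + s%:Z) * e (b, p - s%:Z).
have PL (s : nat) : (s < N)%N -> L (P s.+1).
  move=> sN; apply: lspan_gen; exists (b, p - s.+1%:Z), (a, m + s.+1%:Z); split=> //.
  by split=> /=; lia.
have QL (s : nat) : (s <= N)%N -> (s < N)%N \/ p != m + N%:Z \/ (a < b)%O -> L (Q s).
  move=> sN H; apply: lspan_gen; exists (a, m + s%:Z), (b, p - s%:Z); split=> //.
  split=> /=; try lia.
  case: (ltP (m + s%:Z) p) => pms; [by left | right].
  by split=> //; try lia; case: H => [|[]]; lia.
have e0 : e (b, p) * e (a, m) = P 0 by rewrite /P subr0 addr0.
have := locality a b lom mp; under eq_bigr do rewrite scalerBr.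
rewrite sumrB => /eqP; rewrite subr_eq0 => /eqP.
rewrite big_ord_recl /= expr0 bin0 mul1r scale1r -[X in X + _]e0 => E.
have LP : L (\sum_(i < N) c i.+1 *: P i.+1) by apply: lspan_sum => i _; apply/lspanZ/PL.
have N1 z : L z -> L (- z) by move=> Lz; rewrite -scaleN1r; apply: lspanZ.
rewrite -/L.
(* If p = m + N, a = b and N is odd, the term s = N of the second sum is
   - e x * e y: the pair occurs with coefficient 2. *)
case: (boolP ((p != m + N%:Z) || (a < b)%O)) => [/orP ok|].
  rewrite -[X in L X](addrK (\sum_(i < N) c i.+1 *: P i.+1)) E.
  apply: lspanD; last exact: N1.
  by apply: lspan_sum => i _; apply/lspanZ/QL; [rewrite -ltnS | right].
rewrite negb_or negbK => /andP[/eqP pm ab].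
have /andP[/eqP ba oN] : (b == a) && odd N.
  by move: adm; rewrite /admissible_pair /= pm (negbTE ab) /=; case: ifP => //; lia.
move: E; rewrite big_ord_recr /= binn mulr1 -signr_odd oN expr1 scaleN1r.
have -> : e (a, m + N%:Z) * e (b, p - N%:Z) = e (b, p) * e (a, m).
  by rewrite ba pm addrK.
set z := e (b, p) * _; set S1 := \sum_i _; set S2 := \sum_i _ => E.
have -> : z = (2%:R^-1 : k) *: (S2 - S1).
  have -> : S2 - S1 = 2%:R *: z.
    have ES : S2 = z + S1 + z by rewrite E subrK.
    by rewrite scaler_nat mulr2n ES addrAC addrK.
  rewrite scalerA mulVf ?scale1r //; by move/pcharf0P: hk => ->.
apply: lspanZ; apply: lspanD; last exact: N1.
by apply: lspan_sum => i _; apply/lspanZ/QL; [apply: ltnW | left].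
Qed.

Definition word_prod w : A := \prod_(x <- w) e x.

Definition straight z := exists2 w, admissible N w && all (fun x => lo <= x.2) w & z = word_prod w.

(** Lexicographic induction on [W] and the number of colour inversions. Lowering the first exponent
    of a pair at fixed sum lowers [W]; an exchange keeps [W] and removes an inversion. Measuring
    exponents from [lo] keeps [W] nonnegative. *)
Lemma straighten w : all (fun x => lo <= x.2) w -> lspan straight (word_prod w).
Proof.
pose W w := wsum [seq x.2 - lo | x <- w]; pose iv w := inversions (map fst w).
have W0 w' : all (fun x => lo <= x.2) w' -> 0 <= W w'.
  elim: w' => //= x w' IH /andP[xl /IH]; rewrite /W /=; nia.
move: {2}(absz (W w)) (erefl (absz (W w))) => n; move: {2}(iv w) (erefl (iv w)) => i.
elim/ltn_ind: n i w => n IHn; elim/ltn_ind=> i IHi w wi wn wlo.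
case: (boolP (admissible N w)) => [aw|/nsortedP[u [x [y [v [we xy]]]]]].
  by apply: lspan_gen; exists w; rewrite ?aw.
move: wlo; rewrite we all_cat /= => /and4P[ulo xlo ylo vlo].
have -> : word_prod (u ++ x :: y :: v) = word_prod u * ((e x * e y) * word_prod v).
  by rewrite /word_prod big_cat /= !big_cons !mulrA.
apply: (@lspan_lspan _ _ (fun z => exists x' y', pair_lt x' y' x y /\
    z = word_prod (u ++ x' :: y' :: v))).
  move=> _ [x' [y' [[xlo' ylo' s xy'] ->]]].
  have lo' : all (fun x => lo <= x.2) (u ++ x' :: y' :: v).
    by rewrite all_cat /= ulo xlo' ylo' vlo.
  have := W0 _ lo'; have W0w : 0 <= W w by apply: W0; rewrite we all_cat /= ulo xlo ylo.
  have : W (u ++ x' :: y' :: v) + (x.2 - lo) = W w + (x'.2 - lo).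
    by rewrite we /W !map_cat /=; apply: wsum_replace; lia.
  case: xy' => [lt|[ex e1 e2 lt]] Weq W0'.
    by apply: (IHn (absz (W (u ++ x' :: y' :: v))) _ _ _ erefl erefl) => //; lia.
  apply: (IHi (iv (u ++ x' :: y' :: v)) _ _ erefl) => //; last by lia.
  by rewrite -wi we /iv !map_cat /= e1 e2 inversions_swap.
apply: (@lspan_mul _ _ (fun z => z = word_prod u) (fun z => exists x' y', pair_lt x' y' x y /\
    z = word_prod (x' :: y' :: v))) => [_ _ -> [x' [y' [lt ->]]]||].
- by exists x', y'; rewrite /word_prod big_cat.
- exact: lspan_gen.
apply: (@lspan_mul _ _ _ (fun z => z = word_prod v) _ _ _ _ (straighten_pair ylo xy)).
  by move=> _ _ [x' [y' [lt ->]]] ->; exists x', y'; rewrite /word_prod !big_cons mulrA.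
exact: lspan_gen.
Qed.

End Straightening.

(** * The three bases *)

Section PresentedLieGenerators.
Variables (k : fieldType) (X : Type) (R : lie_term k X -> Prop).

Lemma lie_eval_pres_gen t : lie_eval (pres_gen R) t = \pi_(pres_lie R) t.
Proof.
elim: t => //= [s -> t ->|a t ->|s -> t ->]; [exact: pres_addE|exact: pres_scaleE|exact: pres_brE].
Qed.

Lemma pres_lie_rel t : R t -> lie_eval (pres_gen R) t = 0.
Proof. by move=> Rt; rewrite lie_eval_pres_gen; apply/pres_eqP/LC_rel. Qed.

Lemma pres_lie_ind (P : pres_lie R -> Prop) :
  (forall x, P (pres_gen R x)) -> P 0 -> (forall x y, P x -> P y -> P (x + y)) ->
  (forall a x, P x -> P (a *: x)) -> (forall x y, P x -> P y -> P (lie x y)) ->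
  forall x, P x.
Proof.
move=> Pg P0 PD PZ Pl; elim/quotW => t; rewrite -lie_eval_pres_gen.
by elim: t => //= [s Ps t Pt|a t Pt|s Ps t Pt]; [exact: PD|exact: PZ|exact: Pl].
Qed.

End PresentedLieGenerators.

Section EnvelopingAlgebraGenerators.
Variables (k : fieldType) (L : lieAlgType k).

Lemma uea_inD (x y : L) : uea_in (x + y) = uea_in x + uea_in y.
Proof. by rewrite /uea_in [RHS]uea_addE; apply/uea_eqP/UC_inD. Qed.

Lemma uea_inZ a (x : L) : uea_in (a *: x) = a *: uea_in x.
Proof. by rewrite /uea_in [RHS]uea_scaleE; apply/uea_eqP/UC_inZ. Qed.

Lemma uea_in_linear : linear (@uea_in k L).
Proof. by move=> a x y; rewrite uea_inD uea_inZ. Qed.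
HB.instance Definition _ := GRing.isLinear.Build k L (uea L) _ (@uea_in k L) uea_in_linear.

Lemma uea_in_lie (x y : L) : uea_in (lie x y) = uea_in x * uea_in y - uea_in y * uea_in x.
Proof.
rewrite -scaleN1r /uea_in [_ * _]uea_mulE [X in _ + _ *: X]uea_mulE [X in _ + X]uea_scaleE.
by rewrite [RHS]uea_addE; apply/uea_eqP/UC_in_lie.
Qed.

Lemma uea_in_sum_lie (n : nat) (c : 'I_n -> k) (x y : 'I_n -> L) :
  uea_in (\sum_i c i *: lie (x i) (y i))
  = \sum_i c i *: (uea_in (x i) * uea_in (y i) - uea_in (y i) * uea_in (x i)).
Proof. by rewrite linear_sum; apply: eq_bigr => i _; rewrite linearZ /= uea_in_lie. Qed.

Lemma uea_ind (P : uea L -> Prop) :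
  (forall x, P (uea_in x)) -> P 0 -> P 1 -> (forall u v, P u -> P v -> P (u + v)) ->
  (forall a u, P u -> P (a *: u)) -> (forall u v, P u -> P v -> P (u * v)) ->
  forall u, P u.
Proof.
move=> Pi P0 P1 PD PZ PM; elim/quotW; elim=> // [s Ps t Pt|a t Pt|s Ps t Pt].
- by rewrite -[\pi_ _ _]uea_addE; apply: PD.
- by rewrite -[\pi_ _ _]uea_scaleE; apply: PZ.
- by rewrite -[\pi_ _ _]uea_mulE; apply: PM.
Qed.

Lemma uea_span (S : uea L -> Prop) : S 1 -> (forall u v, S u -> S v -> S (u * v)) ->
  (forall x, lspan S (uea_in x)) -> forall u, lspan S u.
Proof.
move=> S1 SM Si; elim/uea_ind => //.
- exact: lspan0.
- exact: lspan_gen.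
- by move=> u v; apply: lspanD.
- by move=> a u; apply: lspanZ.
- by move=> u v; apply: lspan_mul.
Qed.

End EnvelopingAlgebraGenerators.

Section InducedLinear.
Variables (k : fieldType) (L : lieAlgType k) (S : L -> Prop).

Lemma induced_pi_linear : linear (fun u : uea L => \pi_(induced S) u).
Proof. by move=> a u v; rewrite -induced_addE -induced_scaleE. Qed.

Definition induced_pi (u : uea L) : induced S := \pi_(induced S) u.
HB.instance Definition _ := GRing.isLinear.Build k (uea L) (induced S) _ induced_pi induced_pi_linear.

Lemma induced_pi_eq0 u : (induced_pi u = 0) <-> u \in left_ideal S.
Proof.
by rewrite -[u in X in _ <-> X]subr0 -induced_eqP -[\pi_ _ 0]/(induced_pi 0) raddf0.
Qed.

End InducedLinear.

Section Bases.
Variables (k : fieldType) (hk : [pchar k] =i pred0).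
Variables (d : Order.disp_t) (B : orderType d) (N : nat).
Notation L := (coeffL k B N).
Notation Lp := (Lplus k B N).
Notation gen := (gen k N).
Notation genp := (genp k N).
Notation U_monomial := (@U_monomial k d B N).
Notation Uplus_monomial := (@Uplus_monomial k d B N).
Implicit Types (w : seq (B * int)).

Definition of_nat_word (w : seq (B * nat)) : seq (B * int) := [seq (x.1, x.2%:Z) | x <- w].
Definition to_nat_word w : seq (B * nat) := [seq (x.1, absz x.2) | x <- w].

Lemma of_nat_wordK : cancel of_nat_word to_nat_word.
Proof. by elim=> //= -[a n] w IH; rewrite /= IH. Qed.

Lemma to_nat_wordK w : all (fun x => 0 <= x.2) w -> of_nat_word (to_nat_word w) = w.
Proof. by elim: w => //= -[a n] w IH /= /andP[n0 /IH ->]; rewrite gez0_abs. Qed.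

Lemma U_monomial_cat w w' : U_monomial (w ++ w') = U_monomial w * U_monomial w'.
Proof. exact: big_cat. Qed.

Lemma Uplus_monomial_cat (w w' : seq (B * nat)) :
  Uplus_monomial (w ++ w') = Uplus_monomial w * Uplus_monomial w'.
Proof. exact: big_cat. Qed.

Lemma gen_locality (a b : B) (m p : int) :
  \sum_(s < N.+1) ((-1) ^+ s * 'C(N, s)%:R) *: lie (gen b (p - s%:Z)) (gen a (m + s%:Z)) = 0.
Proof.
rewrite -[RHS](@pres_lie_rel k _ (@locality_rel k B N) (locality_term k N a b m p)).
  by rewrite lie_eval_locality.
by exists a, b, m, p.
Qed.

Lemma lspan_U_monomial u : lspan (fun z => exists w, z = U_monomial w) u.
Proof.
apply: uea_span u => [|_ _ [w ->] [w' ->]|].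
- by exists [::]; rewrite /Defs.U_monomial big_nil.
- by exists (w ++ w'); rewrite U_monomial_cat.
elim/pres_lie_ind => [[b n]||x y|a x|x y].
- by apply: lspan_gen; exists [:: (b, n)]; rewrite /Defs.U_monomial big_seq1.
- by rewrite raddf0; apply: lspan0.
- by rewrite uea_inD; apply: lspanD.
- by rewrite uea_inZ; apply: lspanZ.
move=> Sx Sy; rewrite uea_in_lie -scaleN1r; apply: lspanD; last apply: lspanZ.
  by apply: lspan_mul Sx Sy => _ _ [w ->] [w' ->]; exists (w ++ w'); rewrite U_monomial_cat.
by apply: lspan_mul Sy Sx => _ _ [w ->] [w' ->]; exists (w ++ w'); rewrite U_monomial_cat.
Qed.

Lemma lspan_admissible u : lspan (fun z => exists2 w, admissible N w & z = U_monomial w) u.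
Proof.
apply: lspan_lspan (lspan_U_monomial u) => _ [w ->].
(* Exponents in L are unbounded below, so the bound that makes rewriting terminate is chosen for
   each word. *)
have [lo wlo] : exists lo : int, all (fun x => lo <= x.2) w.
  elim: w => [|x w [lo IH]]; first by exists 0.
  exists (Num.min lo x.2); rewrite /= ge_min lexx orbT /=.
  by apply: sub_all IH => y; rewrite ge_min => ->.
have loc (a b : B) (m p : int) : lo <= m -> m + N%:Z <= p ->
    \sum_(s < N.+1) ((-1) ^+ s * 'C(N, s)%:R) *:
      (uea_in (gen b (p - s%:Z)) * uea_in (gen a (m + s%:Z))
       - uea_in (gen a (m + s%:Z)) * uea_in (gen b (p - s%:Z))) = 0.
  by move=> _ _; rewrite -uea_in_sum_lie gen_locality raddf0.
have := straighten hk (e := fun x => uea_in (gen x.1 x.2)) loc wlo.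
apply: lspan_lspan => _ [w' /andP[aw' _] ->].
by apply: lspan_gen; exists w'.
Qed.

Lemma U_basis : is_basis (fun w => admissible N w) U_monomial.
Proof.
split=> [s c us sP s0|u]; last exact: lspan_family (lspan_admissible u).
apply: (admissible_free (N := N) hk us sP) => // phi w _ _.
by rewrite s0 raddf0.
Qed.

(** A predicate on L rather than on [Lplus], because the induction over [conformal] runs through
    coefficients in L. Nonempty words guarantee a last letter of nonnegative exponent. *)
Definition positive_span (x : L) : Prop := exists2 y : Lp, Lplus_val y = x &
  lspan (fun z => exists2 w, w != [::] & z = Uplus_monomial w) (uea_in y).

Lemma positive_span0 : positive_span 0.
Proof. by exists 0; rewrite ?raddf0 //; apply: lspan0. Qed.

Lemma positive_spanD x y : positive_span x -> positive_span y -> positive_span (x + y).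
Proof.
move=> [x' <- Sx] [y' <- Sy]; exists (x' + y') => //.
by rewrite uea_inD; apply: lspanD.
Qed.

Lemma positive_spanZ a x : positive_span x -> positive_span (a *: x).
Proof. by move=> [x' <- Sx]; exists (a *: x') => //; rewrite uea_inZ; apply: lspanZ. Qed.

Lemma positive_span_lie x y : positive_span x -> positive_span y -> positive_span (lie x y).
Proof.
move=> [x' <- Sx] [y' <- Sy]; exists (lie x' y') => //.
rewrite uea_in_lie -scaleN1r; apply: lspanD; last apply: lspanZ.
  apply: lspan_mul Sx Sy => _ _ [[//|p w] _ ->] [w' _ ->].
  by exists (p :: w ++ w'); rewrite // -cat_cons Uplus_monomial_cat.
apply: lspan_mul Sy Sx => _ _ [[//|p w] _ ->] [w' _ ->].
by exists (p :: w ++ w'); rewrite // -cat_cons Uplus_monomial_cat.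
Qed.

Lemma positive_span_sum (I : Type) (r : seq I) (P : pred I) (F : I -> L) :
  (forall i, P i -> positive_span (F i)) -> positive_span (\sum_(i <- r | P i) F i).
Proof. by move=> PF; apply: big_ind => //; [exact: positive_span0 | exact: positive_spanD]. Qed.

(** Nonnegative coefficients of derivatives and circle products involve only nonnegative
    coefficients of their arguments; the coefficient of a derivative at 0 has the factor 0. *)
Lemma conformal_positive_span c : @conformal k B N c -> forall n : nat, positive_span (c n%:Z).
Proof.
elim=> {c} [b n|n|a b _ IHa _ IHb n|c a _ IH n|a _ IH [|n]|m a b _ IHa _ IHb n].
- exists (genp b n) => //; apply: lspan_gen; exists [:: (b, n)] => //.
  by rewrite /Defs.Uplus_monomial big_seq1.
- exact: positive_span0.
- exact: positive_spanD.
- exact: positive_spanZ.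
- by rewrite /Dseries oppr0 scale0r; apply: positive_span0.
- by rewrite /Dseries -[n.+1%:Z]/(1 + n)%N%:Z PoszD addrAC subrr add0r; apply: positive_spanZ.
- rewrite /circ; apply: positive_span_sum => -[s] /=; rewrite ltnS => sm _.
  by apply: positive_spanZ; apply: positive_span_lie; [rewrite subzn | rewrite -PoszD].
Qed.

Lemma lspan_Uplus_in (y : Lp) :
  lspan (fun z => exists2 w, w != [::] & z = Uplus_monomial w) (uea_in y).
Proof.
suff [y' /val_inj -> //] : positive_span (Lplus_val y).
have /lspan_predP[n [a [v [Sv ->]]]] := Lplus_valP y.
apply: positive_span_sum => i _; apply: positive_spanZ.
by have [c [m [/conformal_positive_span ? ->]]] := Sv i.
Qed.

Lemma lspan_Uplus_monomial u : lspan (fun z => exists w : seq (B * nat), z = Uplus_monomial w) u.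
Proof.
apply: uea_span u => [|_ _ [w ->] [w' ->]|y].
- by exists [::]; rewrite /Defs.Uplus_monomial big_nil.
- by exists (w ++ w'); rewrite Uplus_monomial_cat.
by apply: lspan_lspan (lspan_Uplus_in y) => _ [w _ ->]; apply: lspan_gen; exists w.
Qed.

(** [absz] lets integer exponents index [genp], as the rewriting expects; in this range it changes
    none of them. *)
Lemma genp_locality (a b : B) (m p : int) : 0 <= m -> m + N%:Z <= p ->
  \sum_(s < N.+1) ((-1) ^+ s * 'C(N, s)%:R) *:
    lie (genp b (absz (p - s%:Z)%R)) (genp a (absz (m + s%:Z)%R)) = 0.
Proof.
move=> m0 mp; apply: val_inj; rewrite raddf0 linear_sum -[RHS](gen_locality a b m p).
apply: eq_bigr => -[s] /=; rewrite ltnS => sN _.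
by congr (_ *: lie (gen _ _) (gen _ _)); lia.
Qed.

Lemma lspan_admissible_Uplus u :
  lspan (fun z => exists2 w, admissible N (of_nat_word w) & z = Uplus_monomial w) u.
Proof.
apply: lspan_lspan (lspan_Uplus_monomial u) => _ [w ->].
have loc (a b : B) (m p : int) : 0 <= m -> m + N%:Z <= p ->
    \sum_(s < N.+1) ((-1) ^+ s * 'C(N, s)%:R) *:
      (uea_in (genp b (absz (p - s%:Z)%R)) * uea_in (genp a (absz (m + s%:Z)%R))
       - uea_in (genp a (absz (m + s%:Z)%R)) * uea_in (genp b (absz (p - s%:Z)%R))) = 0.
  by move=> m0 mp; rewrite -uea_in_sum_lie genp_locality // raddf0.
pose e (x : B * int) := uea_in (genp x.1 (absz x.2)).
have wlo : all (fun x => 0 <= x.2) (of_nat_word w) by apply/allP => _ /mapP[x _ ->].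
have := straighten hk (e := e) loc wlo.
have eE w' : word_prod e w' = Uplus_monomial (to_nat_word w').
  by rewrite /word_prod /Defs.Uplus_monomial big_map.
rewrite eE of_nat_wordK; apply: lspan_lspan => _ [w' /andP[aw' lo'] ->].
by apply: lspan_gen; exists (to_nat_word w'); rewrite ?to_nat_wordK ?eE.
Qed.

Lemma exists_Uplus_inclusion : exists F : {lrmorphism uea Lp -> uea L},
  (forall y : Lp, F (uea_in y) = uea_in (Lplus_val y)) /\
  forall w : seq (B * nat), F (Uplus_monomial w) = U_monomial (of_nat_word w).
Proof.
have lin : linear (fun y : Lp => uea_in (Lplus_val y)).
  by move=> a x y; rewrite -uea_in_linear.
have [F FE] := uea_universal lin (fun x y => uea_in_lie (Lplus_val x) (Lplus_val y)).
exists F; split=> // w; rewrite rmorph_prod /Defs.U_monomial big_map.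
by apply: eq_bigr => x _; apply: FE.
Qed.

(** For independence, a relation is mapped to U(L), where its monomials become distinct admissible
    ones. *)
Lemma Uplus_basis : is_basis (fun w : seq (B * nat) => admissible N (of_nat_word w)) Uplus_monomial.
Proof.
split=> [s c us sP s0 w ws|u]; last exact: lspan_family (lspan_admissible_Uplus u).
have [F [_ FE]] := exists_Uplus_inclusion.
have us' : uniq (map of_nat_word s) by rewrite map_inj_uniq //; apply: can_inj of_nat_wordK.
have sP' : all (fun w => admissible N w) (map of_nat_word s) by rewrite all_map.
have := admissible_free (c := c \o to_nat_word) hk us' sP' (fun _ => id) _ (map_f _ ws).
rewrite /= of_nat_wordK; apply=> phi w' _ _.
rewrite big_map; under eq_bigr => x _ do rewrite /= of_nat_wordK -FE -linearZ.
by rewrite -linear_sum s0 !raddf0.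
Qed.

Lemma V_monomial_pi w : V_monomial k N w = induced_pi _ (U_monomial w).
Proof.
rewrite /V_monomial /Defs.U_monomial; elim: w => [|x w IH] /=; first by rewrite big_nil.
by rewrite big_cons IH [LHS]induced_actE.
Qed.

(** In a generator u x of the ideal, u is a combination of words and x one of nonempty words with
    nonnegative exponents. The product is a combination of words whose last exponent is nonnegative,
    and [phi] kills these by [word_fun_last_neg]. *)
Lemma word_functional_left_ideal (phi : {linear uea L -> k^o}) w :
  admissible N w -> last_neg w ->
  (forall w', phi (U_monomial w') = word_fun k N w w') ->
  forall z, z \in left_ideal (@is_Lplus k B N) -> phi z = 0.
Proof.
move=> aw nw phiE z /lspan_predP zS.
suff : lspan (fun z => z = 0) (phi z).
  by move=> [n [a [v [v0 ->]]]]; rewrite big1 // => i _; rewrite v0 scaler0.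
apply: lspan_image zS => _ [u [x [Lx ->]]].
have [F [Fin FE]] := exists_Uplus_inclusion.
have [y <-] : exists y : Lp, Lplus_val y = x by exists (MkLplus (introT (lspan_predP _ _) Lx)).
apply: (@lspan_image _ _ _ _ (fun z => exists w', ~~ last_neg w' /\ z = U_monomial w')).
  move=> _ [w' [nw' ->]]; apply: lspan_gen; rewrite phiE; apply/eqP.
  by apply: contraNT nw'; apply: word_fun_last_neg.
rewrite -Fin; apply: (@lspan_mul _ _ (fun z => exists w1, z = U_monomial w1)
  (fun z => exists2 w', w' != [::] & z = U_monomial (of_nat_word w'))).
- move=> _ _ [w1 ->] [[//|p w2] _ ->]; exists (w1 ++ of_nat_word (p :: w2)).
  rewrite U_monomial_cat; split=> //.
  have -> : last_neg (w1 ++ of_nat_word (p :: w2)) = last_neg (of_nat_word (p :: w2)).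
    by case: w1 => //= q w1; rewrite last_cat.
  by rewrite /= (last_map (fun q : B * nat => (q.1, q.2%:Z))).
- exact: lspan_U_monomial.
apply: lspan_image (lspan_Uplus_in y) => _ [w' w'0 ->].
by apply: lspan_gen; exists w'; last exact: FE.
Qed.

Lemma V_basis : is_basis (fun w => admissible N w && last_neg w) (V_monomial k N).
Proof.
split=> [s c us sP s0|].
  apply: (admissible_free (N := N) hk us sP) => [w /andP[] //|phi w /andP[aw nw] phiE].
  apply: (word_functional_left_ideal aw nw phiE); apply/induced_pi_eq0.
  rewrite linear_sum -[RHS]s0; apply: eq_bigr => w' _.
  by rewrite linearZ V_monomial_pi.
elim/quotW => u; apply: lspan_family.
apply: (@lspan_image _ _ _ (induced_pi _) _ _ _ _ (lspan_admissible u)) => _ [w aw ->].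
case nw: (last_neg w).
  by apply: lspan_gen; exists w; rewrite ?aw // V_monomial_pi.
(* A word whose last exponent is nonnegative lies in the left ideal, since its last letter is in
   L_+. *)
suff E : induced_pi (@is_Lplus k B N) (U_monomial w) = 0 by rewrite /= E; apply: lspan0.
apply/induced_pi_eq0/lspan_predP/lspan_gen.
case/lastP: w nw {aw} => // w [b n] nw.
have n0 : 0 <= n by move: nw; case: w => [|x w] /=; rewrite ?last_rcons /=; lia.
exists (U_monomial w), (gen b n); split.
  rewrite -[n]gez0_abs //; apply: lspan_gen.
  by exists (gen_series k N b), (absz n); split=> //; apply: Conf_gen.
by rewrite -cats1 U_monomial_cat {2}/Defs.U_monomial big_seq1.
Qed.

End Bases.

Theorem mainTheorem1 (k : fieldType) (hk : [pchar k] =i pred0)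
    (d : Order.disp_t) (B : orderType d) (N : nat) :
  [/\ is_basis (fun w : seq (B * int) => admissible N w)
        (fun w : seq (B * int) => U_monomial k N w),
      is_basis
        (fun w : seq (B * nat) => admissible N [seq (x.1, x.2%:Z) | x <- w])
        (fun w : seq (B * nat) => Uplus_monomial k N w)
    & is_basis (fun w : seq (B * int) => admissible N w && last_neg w)
        (fun w : seq (B * int) => V_monomial k N w)].
Proof. by split; [exact: U_basis | exact: Uplus_basis | exact: V_basis]. Qed.
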